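(* Let $L/F_0$ be a cyclic Galois field extension of degree $n$ with $\mathrm{Gal}(L/F_0)=\langle\sigma\rangle$ and $F/F_0$ a cyclic Galois field extension of degree $m$ with $\mathrm{Gal}(F/F_0)=\langle\tau\rangle$, with $L$ and $F$ linearly disjoint over $F_0$, and let $K=L\otimes_{F_0}F$ be their composite. Let $(F/F_0,\tau,d)$ be a nonassociative cyclic algebra of degree $m$ (so $d\in F\setminus F_0$). Let $D_0=(L/F_0,\sigma,c)$ be an associative cyclic algebra over $F_0$ of degree $n$ (so $c\in F_0^\times$) such that $D=D_0\otimes_{F_0}F=(K/F,\sigma,c)$ is a division algebra. (a) Let $m=4$. Then $(L/F_0,\sigma,c)\otimes_{F_0}(F/F_0,\tau,d)$ is a division algebra if and only if $$d\ne z\,\widetilde\tau(z)\widetilde\tau^2(z)\widetilde\tau^3(z)\quad\text{for all }z\in D,$$ and, for all $z_0,z_1\in D$, $$\widetilde\tau^2(z_1)\widetilde\tau^3(z_1)z_1+\widetilde\tau^2(z_0)z_1+\widetilde\tau^2(z_1)\widetilde\tau^3(z_0)\ne 0\quad\text{or}\quad \widetilde\tau^2(z_0)z_0+\widetilde\tau^2(z_1)\widetilde\tau^3(z_1)z_0\ne d .$$ (b) Suppose that $m$ is prime and, in case $m\ne2,3$, additionally that $F_0$ contains a primitive $m$th root of unity. (i) If $\tau(d^n)\ne d^n$, then $(L/F_0,\sigma,c)\otimes_{F_0}(F/F_0,\tau,d)$ is a division algebra. (ii) If $d^n\notin N_{D/F_0}(D^\times)$, then $(L/F_0,\sigma,c)\otimes_{F_0}(F/F_0,\tau,d)$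 is a division algebra. (iii) If $d^n\notin F_0$, then $(L/F_0,\sigma,c)\otimes_{F_0}(F/F_0,\tau,d)$ is a division algebra.
   Context: Algebras are unital but not necessarily associative. A nonzero algebra $A$ is a division algebra if for every $a\ne0$ in $A$ the left and right multiplications by $a$ are bijective. Cyclic algebras: for a cyclic Galois extension $E/k$ of degree $r$ with $\mathrm{Gal}(E/k)=\langle\rho\rangle$ and $a\in E^\times$, $(E/k,\rho,a)=E\oplus eE\oplus\dots\oplus e^{r-1}E$ is the $k$-algebra with biadditive multiplication, for $x,y\in E$, $0\le i,j<r$, $(e^ix)(e^jy)=e^{i+j}\rho^j(x)y$ if $i+j<r$, and $(e^ix)(e^jy)=e^{(i+j)-r}a\rho^j(x)y$ if $i+j\ge r$. It is associative if $a\in k^\times$ (an associative cyclic algebra), and is called a nonassociative cyclic algebra of degree $r$ if $a\in E\setminus k$. Extensions: $\sigma$ and $\tau$ are canonically extended to $K$: $\sigma$ is the identity on $F$, and $\tau$ is the identity on $L$. The map $\widetilde\tau$: on $D=(K/F,\sigma,c)$, $\widetilde\tau(\sum_i e^ix_i)=\sum_i e^i\tau(x_i)$ ($x_i\in K$); it is a ring automorphism of $D$. Norms: $N_{D/F}$ is the reduced norm of the central simple $F$-algebra $D$, and $N_{D/F_0}=N_{F/F_0}\circ N_{D/F}$, with $N_{F/F_0}$ the field norm. *)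

(* Defs.v *)
From HB Require Import structures.
From mathcomp Require Import all_boot all_order all_algebra all_fingroup all_field.
Set Implicit Arguments.
Unset Strict Implicit.
Unset Printing Implicit Defensive.
Import GRing.Theory.
Local Open Scope ring_scope.

(* Algebras need not be associative, so they are given by an additive group
   (or a vector space) together with a bare multiplication function. *)
Definition division_algebra (A : zmodType) (mul : A -> A -> A) : Prop :=
  (exists a : A, a != 0) /\
  forall a : A, a != 0 -> bijective (mul a) /\ bijective (mul^~ a).

(* The carrier of (E/k, rho, a): x stands for \sum_(i < r) e^i (x i). *)
Notation cyclic_carrier E r := {ffun 'I_r -> E}.

Section CyclicAlgebra.
Variables (E : fieldType) (r : nat).
Implicit Types x y : cyclic_carrier E r.

(* e^k z *)
Definition cyclic_mono (k : nat) (z : E) : cyclic_carrier E r :=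
  [ffun l : 'I_r => if l == k :> nat then z else 0].

Definition cyclic_mul (rho : E -> E) (a : E) x y : cyclic_carrier E r :=
  \sum_(i < r) \sum_(j < r)
    if (i + j < r)%N then cyclic_mono (i + j) (iter j rho (x i) * y j)
    else cyclic_mono (i + j - r) (a * iter j rho (x i) * y j).

Definition cyclic_map (f : E -> E) x : cyclic_carrier E r :=
  [ffun i => f (x i)].

End CyclicAlgebra.

(* A (x)_k B for finite dimensional A and B, in coordinates: M stands for the
   sum of the M i j *: (e_i (x) f_j), where (e_i) and (f_j) are bases of A
   and B. *)
Section Tensor.
Variables (k : fieldType) (A B : vectType k).
Local Notation AB := ('M[k]_(\dim {:A}, \dim {:B})).
Local Notation e := (vbasis {:A}).
Local Notation f := (vbasis {:B}).

Definition tensor (a : A) (b : B) : AB :=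
  \matrix_(i, j) (coord e i a * coord f j b).

Variables (mulA : A -> A -> A) (mulB : B -> B -> B).

Definition tensor_mul (M N : AB) : AB :=
  \sum_i \sum_j \sum_p \sum_q
    (M i j * N p q) *: tensor (mulA e`_i e`_p) (mulB f`_j f`_q).

(* tensor_mul is k-bilinear, so the next lemma says that it is the usual
   multiplication of the tensor product of two algebras. *)
Lemma tensor_mulE (a a' : A) (b b' : B) :
    (forall x, linear (mulA x)) -> (forall y, linear (mulA^~ y)) ->
    (forall x, linear (mulB x)) -> (forall y, linear (mulB^~ y)) ->
  tensor_mul (tensor a b) (tensor a' b') = tensor (mulA a a') (mulB b b').
Proof.
have exp (V : vectType k) (mul : V -> V -> V) :
    (forall x, linear (mul x)) -> (forall y, linear (mul^~ y)) ->
    forall v w (t := vbasis {:V}) l,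
    coord t l (mul v w) =
    \sum_i \sum_p coord t i v * coord t p w * coord t l (mul t`_i t`_p).
  move=> lr ll v w t l.
  have sumr x I (s : seq I) (c : I -> k) (F : I -> V) :
      mul x (\sum_(i <- s) c i *: F i) = \sum_(i <- s) c i *: mul x (F i).
    pose g : {linear V -> V} := HB.pack (mul x)
      (GRing.isLinear.Build _ _ _ _ (mul x) (lr x)).
    by rewrite -[mul x]/(g : V -> V) linear_sum; apply: eq_bigr => i _;
       rewrite linearZ.
  have suml y I (s : seq I) (c : I -> k) (F : I -> V) :
      mul (\sum_(i <- s) c i *: F i) y = \sum_(i <- s) c i *: mul (F i) y.
    pose g : {linear V -> V} := HB.pack (mul^~ y)
      (GRing.isLinear.Build _ _ _ _ (mul^~ y) (ll y)).
    by rewrite -[LHS]/(g _) linear_sum; apply: eq_bigr => i _; rewrite linearZ.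
  rewrite {1}(coord_vbasis (memvf v)) suml linear_sum; apply: eq_bigr => i _.
  rewrite linearZ /= {1}(coord_vbasis (memvf w)) sumr linear_sum mulr_sumr.
  by apply: eq_bigr => p _; rewrite linearZ /= mulrA.
move=> lAr lAl lBr lBl; apply/matrixP=> r s.
rewrite mxE (exp _ _ lAr lAl) (exp _ _ lBr lBl) mulr_suml summxE.
apply: eq_bigr => i _; rewrite mulr_suml summxE.
under eq_bigr do rewrite summxE.
rewrite exchange_big /=; apply: eq_bigr => p _.
rewrite mulr_sumr; apply: eq_bigr => j _.
rewrite summxE mulr_sumr; apply: eq_bigr => q _.
by rewrite !mxE [in LHS](mulrACA (coord e i a)) [LHS]mulrACA.
Qed.

End Tensor.

Section ReducedNorm.
Variables (F : fieldType) (D : vectType F) (mul : D -> D -> D) (one : D).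

(* phi is a unital ring morphism, semilinear along iota : F -> E, whose
   E-linear extension D (x)_F E -> M_p(E) is bijective. *)
Definition splitting (E : fieldType) (iota : {rmorphism F -> E}) (p : nat)
    (phi : D -> 'M[E]_p) : Prop :=
  [/\ forall x y, phi (x + y) = phi x + phi y,
      forall t x, phi (t *: x) = iota t *: phi x,
      forall x y, phi (mul x y) = phi x *m phi y,
      phi one = 1%:M &
      basis_of fullv [seq phi x | x <- vbasis {:D}]].

(* y = N_{D/F}(x); the determinant does not depend on the splitting. *)
Definition is_reduced_norm (x : D) (y : F) : Prop :=
  exists (E : fieldType) (iota : {rmorphism F -> E}) (p : nat)
         (phi : D -> 'M[E]_p),
    splitting iota phi /\ \det (phi x) = iota y.

End ReducedNorm.

(* L and F are linearly disjoint over k inside K, an extension of F into which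
   L embeds by iL, and K is their composite LF. *)
Definition disjoint_composite (k : fieldType) (L F : fieldExtType k)
    (K : fieldExtType F) (iL : L -> K) : Prop :=
  [/\ forall a : k, iL a%:A = (a%:A : F)%:A,
      forall X : seq L, free X -> free (map iL X) &
      <<1 & map iL (vbasis {:L})>>%VS = {:K}%VS].

(* Main.v *)
Require Import Defs.
From HB Require Import structures.
From mathcomp Require Import all_boot all_order all_algebra all_fingroup.
From mathcomp Require Import all_field cyclic.
Set Implicit Arguments.
Unset Strict Implicit.
Unset Printing Implicit Defensive.
Import GRing.Theory.
Local Open Scope ring_scope.

(** Let D = (K/F, sigma, c) and extend tau to the automorphism of D that acts on
    coordinates. Over D the tensor product becomes
    V = D + t D + ... + t^(m-1) D with x t = t tau(x) and t^m replaced by d,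
    that is, the left module R/R(t^m - d) over the skew polynomials R in t, with
    a multiplication that is not associative because tau moves d. A submodule is
    a left D-subspace of V that is stable under left multiplication T by t, and
    everything is read off from such subspaces. Their dimensions are counted
    over F0, in multiples of the dimension of D.

    If V has no stable subspace besides 0 and V, it is a division algebra
    ([simple_division]): for h != 0 the vectors h, T h, ..., T^(m-1) h are then
    independent over D, and they span V; but the product of the sum of the
    t^i x_i by h is the sum of the T^i (x_i h).

    A stable subspace U of codimension j over D contains
    T^j 1 - (x_0 1 + x_1 T 1 + ... + x_(j-1) T^(j-1) 1) for suitable x_i, and
    1, ..., T^(j-1) 1 are independent modulo U ([chain_exists],
    [stable_codim]). Computing T^m 1 = d modulo U from this relation gives
    equations for d. In codimension 1 they say d = z tau(z) ... tau^(m-1)(z)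
    ([coeigen_norm]). The same equation holds if U has dimension 1 and so is
    spanned by an eigenvector of T ([eigen_norm]). For m = 4 only codimension 2
    remains, and it yields exactly the two equations of part (a); conversely, a
    solution of the equations factors t^4 - d and hence produces zero divisors
    in V ([division_quartic]).

    For m = 2, 3 dimension or codimension 1 is all there is
    ([simple_low_degree]). For other primes m, let w be a primitive m-th root of
    unity. The map t^i x |-> w^i t^i x permutes the stable subspaces, and the
    sum of the images of a minimal one U under its powers is all of V. Hence V
    is a direct sum of some of these images, the D-dimension of U divides m, and
    it is 1 unless U = V ([simple_prime]).

    So in part (b), if the tensor product is not a division algebra, then
    d = z tau(z) ... tau^(m-1)(z) for some z in D. Taking reduced norms gives
    d^n = N_(D/F0)(z) ([skew_norm_reduced_norm]), which contradicts (ii), and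
    also (i) and (iii) because norms lie in F0. The reduced norm is the
    determinant of left multiplication on D viewed as a right K-space: this
    representation splits D by Dedekind independence ([reg_mx_splitting]), and
    its determinants lie in F since applying sigma to coordinates amounts to
    conjugation by e in D ([det_reg_mx_fixed], [sigmaK_fixed]). *)

(** * Iterates and coordinates *)

Lemma dim_ffun_ord (k : fieldType) (n : nat) (vT : vectType k) :
  \dim {:{ffun 'I_n -> vT}} = (n * \dim {:vT})%N.
Proof. by rewrite !dimvf /dim /= card_ord. Qed.

Fact iter_zmod_morphism (V : zmodType) (f : {additive V -> V}) k :
  zmod_morphism (iter k f).
Proof. by elim: k => [|k IHk] x y //=; rewrite IHk raddfB. Qed.

HB.instance Definition _ (V : zmodType) (f : {additive V -> V}) k :=
  GRing.isZmodMorphism.Build V V (iter k f) (iter_zmod_morphism f k).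

Fact iter_monoid_morphism (S : nzRingType) (f : {rmorphism S -> S}) k :
  monoid_morphism (iter k f).
Proof.
split; first by elim: k => //= k ->; rewrite rmorph1.
by elim: k => [|k IHk] x y //=; rewrite IHk rmorphM.
Qed.

HB.instance Definition _ (S : nzRingType) (f : {rmorphism S -> S}) k :=
  GRing.isMonoidMorphism.Build S S (iter k f) (iter_monoid_morphism f k).

Fact iter_scalable (R : nzRingType) (V : lmodType R) (f : {linear V -> V}) k :
  scalable (iter k f).
Proof. by elim: k => [|k IHk] x y //=; rewrite IHk linearZ. Qed.

HB.instance Definition _ (R : nzRingType) (V : lmodType R)
    (f : {linear V -> V}) k :=
  GRing.isScalable.Build R V V *:%R (iter k f) (iter_scalable f k).

(** * Cyclic algebras over a noncommutative base *)

(** The same construction serves twice: over a field it is the cyclic algebra D,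
    and over D it is the tensor product of the theorem. *)
Section SkewCyclic.

Variables (S : nzRingType) (r : nat).
Local Notation C := {ffun 'I_r.+1 -> S}.
Implicit Types (x y z : S) (v w : C).

Definition mono (k : nat) z : C :=
  [ffun l : 'I_r.+1 => if l == k :> nat then z else 0].

Fact mono_zmod_morphism k : zmod_morphism (mono k).
Proof.
by move=> x y; apply/ffunP=> l; rewrite !ffunE; case: eqP; rewrite ?subr0.
Qed.

HB.instance Definition _ k :=
  GRing.isZmodMorphism.Build S C (mono k) (mono_zmod_morphism k).

Lemma sum_mono v : v = \sum_(i < r.+1) mono i (v i).
Proof.
apply/ffunP=> l; rewrite sum_ffunE (bigD1 l) //= ffunE eqxx big1 ?addr0 // => i.
by rewrite ffunE eq_sym -val_eqE => /negPf->.
Qed.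

Variables (rho : {rmorphism S -> S}) (a : S).

(** Left multiplication by x, from the rule x t^l = t^l rho^l(x). *)
Definition act x v : C := [ffun l : 'I_r.+1 => iter l rho x * v l].

(** Left multiplication by t, where t^r.+1 = a. *)
Definition shift v : C :=
  [ffun l : 'I_r.+1 => if l == 0 :> nat then a * v ord_max else v (inord l.-1)].

(** The sum of t^i (v_i w). Written with operators, the product depends on the
    left factor only through compositions of [shift] and [act]; this is what
    makes associativity and the study of left submodules easy. *)
Definition skew_mul v w : C := \sum_(i < r.+1) iter i shift (act (v i) w).

Fact act_zmod_morphism x : zmod_morphism (act x).
Proof. by move=> v w; apply/ffunP=> l; rewrite !ffunE mulrBr. Qed.

HB.instance Definition _ x :=
  GRing.isZmodMorphism.Build C C (act x) (act_zmod_morphism x).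

Fact shift_zmod_morphism : zmod_morphism shift.
Proof.
by move=> v w; apply/ffunP=> l; rewrite !ffunE; case: eqP; rewrite ?mulrBr.
Qed.

HB.instance Definition _ :=
  GRing.isZmodMorphism.Build C C shift shift_zmod_morphism.

Fact skew_mul_zmod_morphism v : zmod_morphism (skew_mul v).
Proof.
move=> w w'; rewrite /skew_mul -sumrB.
by apply: eq_bigr => i _; rewrite !raddfB.
Qed.

HB.instance Definition _ v :=
  GRing.isZmodMorphism.Build C C (skew_mul v) (skew_mul_zmod_morphism v).

Lemma actBl x y v : act (x - y) v = act x v - act y v.
Proof. by apply/ffunP=> l; rewrite !ffunE rmorphB mulrBl. Qed.

Lemma actDl x y v : act (x + y) v = act x v + act y v.
Proof. by apply/ffunP=> l; rewrite !ffunE rmorphD mulrDl. Qed.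

Lemma act0l v : act 0 v = 0.
Proof. by rewrite -(subrr 0) actBl subrr. Qed.

Lemma act1 v : act 1 v = v.
Proof. by apply/ffunP=> l; rewrite ffunE rmorph1 mul1r. Qed.

Lemma actM x y v : act (x * y) v = act x (act y v).
Proof. by apply/ffunP=> l; rewrite !ffunE rmorphM mulrA. Qed.

Lemma skew_mulDl v v' w : skew_mul (v + v') w = skew_mul v w + skew_mul v' w.
Proof.
by rewrite -big_split; apply: eq_bigr => i _; rewrite ffunE actDl raddfD.
Qed.

Lemma skew_mul0l w : skew_mul 0 w = 0.
Proof. by rewrite /skew_mul big1 // => i _; rewrite ffunE act0l raddf0. Qed.

Lemma skew_mul_suml I (s : seq I) (P : pred I) (F : I -> C) w :
  skew_mul (\sum_(i <- s | P i) F i) w = \sum_(i <- s | P i) skew_mul (F i) w.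
Proof.
apply: (big_morph (skew_mul^~ w)) => [v v'|]; first exact: skew_mulDl.
exact: skew_mul0l.
Qed.

Lemma act_mono x j z : act x (mono j z) = mono j (iter j rho x * z).
Proof.
by apply/ffunP=> l; rewrite !ffunE; case: eqP => [->|]; rewrite ?mulr0.
Qed.

Lemma shift_mono j z : (j <= r)%N ->
  shift (mono j z) = if (j < r)%N then mono j.+1 z else mono 0 (a * z).
Proof.
move=> le_jr; apply/ffunP=> l; rewrite ltn_neqAle le_jr andbT.
rewrite !ffunE /= [r == j]eq_sym; have lt_lr := ltn_ord l.
case: (posnP l) => [l0|l_gt0].
  by case: eqP => _; rewrite ffunE l0 ?eqxx ?mulr0.
rewrite inordK; last by rewrite prednK // ltnW.
rewrite -[l.-1 == j]eqSS prednK //.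
case: (j =P r) => [->|_] /=; rewrite ffunE ?(gtn_eqF l_gt0) //.
by rewrite ltn_eqF.
Qed.

Lemma iter_shift_mono i j z : (i <= r)%N -> (j <= r)%N ->
  iter i shift (mono j z) =
    if (i + j <= r)%N then mono (i + j) z else mono (i + j - r.+1) (a * z).
Proof.
move=> + le_jr; elim: i => [_|i IHi lt_ir]; first by rewrite le_jr.
rewrite iterS (IHi (ltnW lt_ir)) addSn.
case: (ltngtP (i + j) r) => [lt_ijr | lt_rij | ->].
- by rewrite shift_mono ?lt_ijr // ltnW.
- have le_ij : (i + j - r.+1 < r)%N.
    by rewrite ltn_subLR // addSn ltnS leq_add // ltnW.
  by rewrite shift_mono ?le_ij ?subSn // ltnW.
by rewrite shift_mono // ltnn subnn.
Qed.

Lemma skew_mul_monol i x v :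
  (i <= r)%N -> skew_mul (mono i x) v = iter i shift (act x v).
Proof.
move=> le_ir; rewrite /skew_mul (bigD1 (inord i)) //= ffunE inordK // eqxx.
rewrite big1 ?addr0 // => l; rewrite -val_eqE /= inordK // ffunE => /negPf->.
by rewrite act0l raddf0.
Qed.

Lemma skew_mul_mono i j x y : (i <= r)%N -> (j <= r)%N ->
  skew_mul (mono i x) (mono j y) =
    if (i + j <= r)%N then mono (i + j) (iter j rho x * y)
    else mono (i + j - r.+1) (a * (iter j rho x * y)).
Proof.
by move=> le_ir le_jr; rewrite -iter_shift_mono // -act_mono skew_mul_monol.
Qed.

(** This is the defining formula of [cyclic_mul], for a noncommutative S. *)
Lemma skew_mulE v w :
  skew_mul v w = \sum_(i < r.+1) \sum_(j < r.+1)
    if (i + j < r.+1)%N then mono (i + j) (iter j rho (v i) * w j)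
    else mono (i + j - r.+1) (a * iter j rho (v i) * w j).
Proof.
rewrite {1}[v]sum_mono skew_mul_suml; apply: eq_bigr => i _.
rewrite {1}[w]sum_mono raddf_sum; apply: eq_bigr => j _.
by rewrite /= skew_mul_mono ?leq_ord ?mulrA.
Qed.

Lemma skew_mul1l v : skew_mul (mono 0 1) v = v.
Proof.
by rewrite skew_mul_monol //= act1.
Qed.

Lemma skew_mul_mono0r v z : skew_mul v (mono 0 z) = [ffun l => v l * z].
Proof.
rewrite {1}[v]sum_mono skew_mul_suml [RHS]sum_mono; apply: eq_bigr => i _.
by rewrite skew_mul_mono ?leq_ord // addn0 leq_ord ffunE.
Qed.

Lemma skew_mul1r v : skew_mul v (mono 0 1) = v.
Proof.
by rewrite skew_mul_mono0r; apply/ffunP=> l; rewrite ffunE mulr1.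
Qed.

Lemma iter_shift_r v : iter r.+1 shift v = [ffun l => a * v l].
Proof.
rewrite {1}[v]sum_mono [RHS]sum_mono raddf_sum; apply: eq_bigr => i _.
rewrite ffunE /= iter_shift_mono ?leq_ord //.
case: (posnP i) => [->|i_gt0]; first by rewrite addn0 leqnn shift_mono ?ltnn.
have -> : (r + i <= r)%N = false.
  by rewrite -[X in (_ <= X)%N]addn0 leq_add2l leqn0 gtn_eqF.
have -> : (r + i - r.+1 = i.-1)%N by rewrite subnS addKn.
by rewrite shift_mono ?(leq_trans (leq_pred _)) ?leq_ord // prednK // leq_ord.
Qed.

Hypothesis rhor : iter r.+1 rho =1 id.
Hypothesis aC : forall x, a * x = x * a.

(** The rule x t = t rho(x). Where t^r.+1 wraps around to a it needs
    rho^(r+1) = 1 and a central. *)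
Lemma act_shift x v : act x (shift v) = shift (act (rho x) v).
Proof.
apply/ffunP=> l; rewrite !ffunE; have := ltn_ord l.
case: posnP => [->|l_gt0] lt_lr.
  by rewrite /= -iterSr rhor mulrA -aC mulrA.
by rewrite inordK ?prednK ?(leq_trans _ lt_lr) // -iterSr prednK.
Qed.

Lemma act_iter_shift x k v :
  act x (iter k shift v) = iter k shift (act (iter k rho x) v).
Proof. by elim: k v x => //= k IHk v x; rewrite act_shift IHk -iterSr. Qed.

Lemma skew_mul_act x v w : skew_mul (act x v) w = act x (skew_mul v w).
Proof.
rewrite /skew_mul raddf_sum; apply: eq_bigr => i _.
by rewrite /= act_iter_shift ffunE actM.
Qed.

(** The associativity (t v) w = t (v w) hinges on the top coordinate: it says
    that t^r.+1 acts on the left as a, which holds as a is fixed by rho. *)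
Lemma skew_mul_shift v w :
  rho a = a -> skew_mul (shift v) w = shift (skew_mul v w).
Proof.
move=> rho_a; rewrite /skew_mul raddf_sum big_ord_recl big_ord_recr /= addrC.
congr (_ + _); last first.
  apply: eq_bigr => i _; rewrite add0n ffunE /=.
  congr (shift (iter i shift (act (v _) w))).
  apply: val_inj; rewrite /= inordK; last exact: ltnW (ltn_ord i).
  by [].
rewrite -iterS iter_shift_r ffunE /= actM; apply/ffunP=> l.
rewrite !ffunE; congr (_ * _); elim: (l : nat) => //= k ->; exact: rho_a.
Qed.

(** By additivity it suffices to move the two kinds of operators, [act] and
    [shift], through the product on the right. *)
Lemma skew_mulA : rho a = a -> associative skew_mul.
Proof.
move=> rho_a u v w; rewrite {1 2}/skew_mul skew_mul_suml; apply: eq_bigr => i _.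
rewrite -skew_mul_act; elim: (i : nat) => //= k IHk.
by rewrite skew_mul_shift // -IHk.
Qed.

End SkewCyclic.
Arguments mono {S r} k z.

Lemma cyclic_mulE (E : fieldType) r (rho : {rmorphism E -> E}) a :
  cyclic_mul rho a =2 skew_mul rho a :> (cyclic_carrier E r.+1 -> _).
Proof. by move=> x y; rewrite skew_mulE. Qed.

(** * The associative cyclic algebra as a finite-dimensional algebra *)

(** What makes the product associative, bundled so that the ring
    structure can be attached to a type that mentions it. *)
Record cyclic_data (k : fieldType) (E : fieldExtType k) (r : nat) :=
  CyclicData {
  cyc_aut : {lrmorphism E -> E};
  cyc_cst : E;
  cyc_autK : iter r.+1 cyc_aut =1 id;
  cyc_aut_cst : cyc_aut cyc_cst = cyc_cst
}.

Section CyclicRing.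

Variables (k : fieldType) (E : fieldExtType k) (r : nat) (X : cyclic_data E r).
Local Notation rho := (cyc_aut X).
Local Notation a := (cyc_cst X).

Definition cyclic_ring of cyclic_data E r : Type := {ffun 'I_r.+1 -> E}.
Local Notation D := (cyclic_ring X).

HB.instance Definition _ := Vector.copy D {ffun 'I_r.+1 -> E}.

Let cmul : D -> D -> D := skew_mul rho a.
Let cone : D := mono 0 1.

Fact cyclic_ring_mulA : associative cmul.
Proof.
exact: (skew_mulA (rho := rho) (@cyc_autK _ _ _ X) (mulrC a) (cyc_aut_cst X)).
Qed.

Fact cyclic_ring_mul1 : left_id cone cmul.
Proof. exact: skew_mul1l. Qed.

Fact cyclic_ring_mulr1 : right_id cone cmul.
Proof. exact: skew_mul1r. Qed.

Fact cyclic_ring_mulDl : left_distributive cmul +%R.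
Proof. by move=> x y z; apply: skew_mulDl. Qed.

Fact cyclic_ring_mulDr : right_distributive cmul +%R.
Proof. by move=> x y z; apply: (raddfD (skew_mul rho a x)). Qed.

Fact cyclic_ring_nonzero : cone != 0.
Proof.
by apply/eqP=> /ffunP/(_ ord0); rewrite !ffunE /=; apply/eqP/oner_neq0.
Qed.

HB.instance Definition _ := GRing.Zmodule_isNzRing.Build D
  cyclic_ring_mulA cyclic_ring_mul1 cyclic_ring_mulr1
  cyclic_ring_mulDl cyclic_ring_mulDr cyclic_ring_nonzero.

Lemma cyclic_ring_mulE (x y : D) : x * y = skew_mul rho a x y.
Proof. by []. Qed.

Lemma cyclic_ring_scaleE t (x : D) : t *: x = [ffun i => t *: (x i : E)].
Proof. by []. Qed.

Fact cyclic_ring_scaleAl t (x y : D) : t *: (x * y) = t *: x * y.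
Proof.
rewrite !cyclic_ring_mulE !skew_mulE [LHS]cyclic_ring_scaleE; apply/ffunP=> l.
rewrite ffunE !sum_ffunE scaler_sumr; apply: eq_bigr => i _.
rewrite !sum_ffunE scaler_sumr; apply: eq_bigr => j _.
rewrite cyclic_ring_scaleE ffunE (iter_scalable rho).
by case: ifP => _; rewrite !ffunE; case: eqP => _;
  rewrite ?scaler0 -?scalerAr -?scalerAl.
Qed.

HB.instance Definition _ :=
  GRing.Lmodule_isLalgebra.Build k D cyclic_ring_scaleAl.

Fact cyclic_ring_scaleAr t (x y : D) : t *: (x * y) = x * (t *: y).
Proof.
rewrite !cyclic_ring_mulE !skew_mulE [LHS]cyclic_ring_scaleE; apply/ffunP=> l.
rewrite ffunE !sum_ffunE scaler_sumr; apply: eq_bigr => i _.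
rewrite !sum_ffunE scaler_sumr; apply: eq_bigr => j _.
rewrite cyclic_ring_scaleE ffunE.
by case: ifP => _; rewrite !ffunE; case: eqP => _;
  rewrite ?scaler0 -?scalerAr -?scalerAl.
Qed.

HB.instance Definition _ :=
  GRing.Lalgebra_isAlgebra.Build k D cyclic_ring_scaleAr.

HB.instance Definition _ := Algebra_isFalgebra.Build k D.

End CyclicRing.

(** * Stable subspaces *)

(** D is a division algebra, and V = D + t D + ... + t^r D with t^r.+1 = d. *)
Section SkewModule.

Variables (k : fieldType) (D : falgType k) (r : nat).
Variables (tau : {lrmorphism D -> D}) (d : D).
Local Notation V := {ffun 'I_r.+1 -> D}.
Local Notation act := (act tau).
Local Notation T := (@shift D r d).
Local Notation e0 := (@mono D r 0 1).
Implicit Types (x y z b : D) (v w u h : V) (U W : {vspace V}).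

Fact act_scalable x : scalable (act x : V -> V).
Proof. by move=> t v; apply/ffunP=> l; rewrite !ffunE scalerAr. Qed.

HB.instance Definition _ x :=
  GRing.isScalable.Build k V V *:%R (act x) (act_scalable x).

Fact shift_scalable : scalable (T : V -> V).
Proof.
move=> t v; apply/ffunP=> l; rewrite !ffunE.
by case: eqP => _; rewrite ?scalerAr.
Qed.

HB.instance Definition _ :=
  GRing.isScalable.Build k V V *:%R (T : V -> V) shift_scalable.

(** [act] as a function of the scalar, so that it gets a linear structure. *)
Definition actr v x : V := act x v.

Fact actr_linear v : linear (actr v).
Proof.
by move=> t x y; apply/ffunP=> l; rewrite !ffunE linearP mulrDl scalerAl.
Qed.

HB.instance Definition _ v :=
  GRing.isLinear.Build k D V *:%R (actr v) (actr_linear v).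

Fact skew_mul_scalable v : scalable (skew_mul tau d v).
Proof.
move=> t w; rewrite /skew_mul scaler_sumr; apply: eq_bigr => i _.
by rewrite act_scalable (iter_scalable T).
Qed.

HB.instance Definition _ v :=
  GRing.isScalable.Build k V V *:%R (skew_mul tau d v) (skew_mul_scalable v).

Definition skew_mulr w v : V := skew_mul tau d v w.

Fact skew_mulr_linear w : linear (skew_mulr w).
Proof.
move=> t u v; rewrite /skew_mulr skew_mulDl /skew_mul scaler_sumr.
congr (_ + _).
apply: eq_bigr => i _; rewrite ffunE -[act _ _]/(actr w _) linearZ.
exact: (iter_scalable T).
Qed.

HB.instance Definition _ w :=
  GRing.isLinear.Build k V V *:%R (skew_mulr w) (skew_mulr_linear w).

(** These are the left ideals of skew polynomials that contain t^r.+1 - d. *)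
Definition stable U :=
  (forall x v, v \in U -> act x v \in U) /\ (forall v, v \in U -> T v \in U).

Lemma stable_iter U i v : stable U -> v \in U -> iter i T v \in U.
Proof. by move=> [_ stT] Uv; elim: i => //= i; apply: stT. Qed.

Hypothesis unitD : forall x, x != 0 -> x \is a GRing.unit.
Hypothesis tauK : iter r.+1 tau =1 id.
Hypothesis dC : forall x, d * x = x * d.
Hypothesis d_neq0 : d != 0.

Local Notation N := (\dim {:D}).

Lemma dim_skew_module : \dim {:V} = (r.+1 * N)%N.
Proof. exact: dim_ffun_ord. Qed.

Lemma dimD_gt0 : (0 < N)%N.
Proof. by rewrite adim_gt0. Qed.

Lemma act_mem_unit U x v :
  (forall y w, w \in U -> act y w \in U) -> act x v \in U -> x != 0 -> v \in U.
Proof.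
move=> stU Uxv /unitD x_unit; rewrite -[v](act1 tau) -(mulVr x_unit) actM.
exact: stU.
Qed.

Definition line v : {vspace V} := limg (linfun (actr v)).

Lemma lineP v w : reflect (exists x, w = act x v) (w \in line v).
Proof.
apply: (iffP memv_imgP) => [[x _ ->]|[x ->]]; exists x; rewrite ?lfunE //.
exact: memvf.
Qed.

(** As D is a division algebra, the line meets U trivially and x |-> x v is
    injective. *)
Lemma dim_add_line U v :
  (forall x w, w \in U -> act x w \in U) -> v \notin U ->
  \dim (U + line v) = (\dim U + N)%N.
Proof.
move=> stU U'v; have x0 x : act x v \in U -> x = 0.
  by move=> Uxv; apply: contraNeq U'v; apply: act_mem_unit Uxv.
rewrite dimv_disjoint_sum; last first.
  apply/eqP; rewrite -subv0; apply/subvP=> w; rewrite memv_cap => /andP[Uw].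
  by move=> /lineP[x Dw]; move: Uw; rewrite Dw => /x0->; rewrite act0l mem0v.
congr (_ + _)%N; apply: limg_dim_eq; apply/eqP; rewrite -subv0 capfv.
apply/subvP=> x; rewrite memv_ker lfunE /= => /eqP xv0.
by rewrite [x]x0 ?mem0v // -[act x v]/(actr v x) xv0 mem0v.
Qed.

Fixpoint chain U h j : {vspace V} :=
  if j is i.+1 then (chain U h i + line (iter i T h))%VS else U.

Lemma chainP U h j v :
  reflect (exists x : nat -> D, v - \sum_(i < j) act (x i) (iter i T h) \in U)
          (v \in chain U h j).
Proof.
apply: (iffP idP) => [|[x +]].
  elim: j v => /= [|j IHj] v.
    by move=> Uv; exists (fun=> 0); rewrite big_ord0 subr0.
  move=> /memv_addP[u /IHj[x Ux] [_ /lineP[y ->] ->]].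
  exists (fun i => if i == j then y else x i).
  rewrite big_ord_recr /= eqxx opprD addrACA subrr addr0.
  by under eq_bigr => i _ do rewrite ltn_eqF //.
elim: j v => /= [|j IHj] v; first by rewrite big_ord0 subr0.
rewrite big_ord_recr /= opprD [- _ - _]addrC addrA => /IHj chv.
rewrite -(subrK (act (x j) (iter j T h)) v) memv_add //.
by apply/lineP; exists (x j).
Qed.

Lemma chain_act U h j : (forall x w, w \in U -> act x w \in U) ->
  forall x w, w \in chain U h j -> act x w \in chain U h j.
Proof.
move=> stU; elim: j => //= j IHj x w /memv_addP[u chu [_ /lineP[y ->] ->]].
rewrite raddfD memv_add ?IHj //; apply/lineP; exists (x * y).
by rewrite actM.
Qed.

(** The inverse of tau is its r-th iterate. *)
Lemma shift_act x v : T (act x v) = act (iter r tau x) (T v).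
Proof. by rewrite (act_shift tauK dC) -iterS tauK. Qed.

Lemma sub_chain U h i j : (i <= j)%N -> (chain U h i <= chain U h j)%VS.
Proof.
elim: j => [|j IHj]; first by rewrite leqn0 => /eqP->.
rewrite leq_eqVlt => /predU1P[->//|/IHj sij].
exact: subv_trans sij (addvSl _ _).
Qed.

(** Once T^j h is a combination of the earlier vectors, T leads nowhere else. *)
Lemma chain_stable U h j :
  stable U -> iter j T h \in chain U h j -> stable (chain U h j).
Proof.
move=> [stU stT] chj; split; first exact: chain_act.
suffices H i : (i <= j)%N ->
    forall v, v \in chain U h i -> T v \in chain U h j by exact: H.
elim: i => [|i IHi] le_ij v /=.
  by move=> /stT; apply: (subvP (sub_chain U h (leq0n j))).
move=> /memv_addP[u chu [_ /lineP[y ->] ->]]; rewrite raddfD memvD //.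
  by apply: IHi => //; apply: ltnW.
rewrite /= shift_act; apply: chain_act => //; rewrite -iterS.
move: le_ij; rewrite leq_eqVlt => /predU1P[Dj|lt_ij]; first by rewrite Dj.
apply: (subvP (sub_chain U h lt_ij)) => /=.
apply: (subvP (addvSr _ _)); by apply/lineP; exists 1; rewrite act1.
Qed.

(** Take j minimal with T^j h in the chain. Up to j every step adds the
    dimension of D, which bounds j and gives independence modulo U. *)
Lemma chain_exists U h : stable U -> exists j,
  [/\ stable (chain U h j), \dim (chain U h j) = (\dim U + j * N)%N,
      (exists x : nat -> D,
         iter j T h - \sum_(i < j) act (x i) (iter i T h) \in U) &
      forall x : nat -> D,
        \sum_(i < j) act (x i) (iter i T h) \in U ->
        forall i, (i < j)%N -> x i = 0].
Proof.
move=> stU; pose P j := iter j T h \in chain U h j.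
have dimP j : (forall i, (i < j)%N -> ~~ P i) ->
    \dim (chain U h j) = (\dim U + j * N)%N.
  elim: j => [|j IHj] notP; first by rewrite addn0.
  rewrite /= dim_add_line ?notP //; last by apply: chain_act; case: stU.
  by rewrite IHj 1?mulSnr ?addnA // => i /ltnW; apply: notP.
have [j Pj minj] : exists2 j, P j & forall i, (i < j)%N -> ~~ P i.
  have /ex_minnP[j Pj minj] : exists j, P j.
    have [/existsP[j Pj]|] := boolP [exists j : 'I_(\dim {:V}).+1, P j].
      by exists j.
    rewrite negb_exists => /forallP notP.
    have := dimP (\dim {:V}).+1 (fun i lt_i => notP (Ordinal lt_i)).
    move=> dim_ch; have := dimvS (subvf (chain U h (\dim {:V}).+1)).
    rewrite dim_ch => le_ch; have /(leq_trans (leq_addl _ _)) := le_ch.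
    by rewrite leqNgt (leq_trans (ltnSn _)) // leq_pmulr ?dimD_gt0.
  by exists j => // i; apply: contraL => /minj; rewrite leqNgt.
exists j; split; [exact: chain_stable | exact: dimP | |].
  exact/chainP.
move=> x; elim: j {Pj} minj => // j IHj notP; rewrite big_ord_recr /= => Ux.
have xj0 : x j = 0.
  apply: contraNeq (notP j (ltnSn j)); apply: act_mem_unit.
    by apply: chain_act; case: stU.
  apply/chainP; exists (fun i => - x i).
  rewrite -sumrN addrC; move: Ux; congr (_ + _ \in U).
  by apply: eq_bigr => i _; rewrite -[act (- _) _]/(actr _ _) raddfN opprK.
move=> i; rewrite ltnS leq_eqVlt => /predU1P[-> //|]; apply: IHj => [l lt_lj|].
  by apply: notP; apply: ltnW.
by move: Ux; rewrite xj0 act0l addr0.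
Qed.

Lemma stable0 : stable 0%VS.
Proof.
by split=> [x v|v]; rewrite !memv0 => /eqP->; rewrite raddf0.
Qed.

(** Applying T until the exponent wraps around turns t^j x into d x, which is
    invertible, and 1 generates V. *)
Lemma mem_mono_full U j x :
  stable U -> (j <= r)%N -> x != 0 -> mono j x \in U -> U = fullv.
Proof.
move=> stU le_jr x0 /(stable_iter (r - j).+1 stU).
rewrite iterS iter_shift_mono ?leq_subr // subnK // leqnn shift_mono // ltnn.
have [stA stT] := stU.
have dx0 : d * x \is a GRing.unit by rewrite unitrMl unitD.
move=> /(stA (d * x)^-1); rewrite act_mono /= mulVr // => U1.
apply/eqP; rewrite eqEsubv subvf /=; apply/subvP=> v _.
rewrite [v]sum_mono memv_suml // => i _.
suff -> : mono i (v i) = iter i T (act (v i) e0) :> V.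
  by apply: stable_iter => //; apply: stA.
by rewrite act_mono /= mulr1 iter_shift_mono ?leq_ord // addn0 leq_ord.
Qed.

Lemma lker0_bijective (f : 'End(V)) : lker f == 0%VS -> bijective f.
Proof.
by move=> f0; exists (f^-1)%VF; [apply: lker0_lfunK | apply: lker0_lfunVK].
Qed.

(** For h != 0 the chain of h from 0 is stable, so it is V, and it takes r.+1
    steps by dimension. Hence right multiplication by h, which sends the sum of
    the t^i x_i to the sum of the T^i (x_i h), is onto, thus injective. So there
    are no zero divisors, and left multiplications are bijective too. *)
Lemma simple_division :
  (forall U, stable U -> U = 0%VS \/ U = fullv) ->
  division_algebra (skew_mul tau d : V -> V -> V).
Proof.
move=> simpleV.
have ker_r h : h != 0 -> lker (linfun (skew_mulr h)) == 0%VS.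
  move=> h0; have [j [stj dimj relj _]] := chain_exists h stable0.
  have chT : chain 0%VS h j = fullv.
    have [ch0|//] := simpleV _ stj.
    case: j ch0 relj {stj dimj} => [_ [x]|j ch0 _].
      by rewrite big_ord0 subr0 memv0 (negPf h0).
    have : h \in chain 0%VS h j.+1.
      apply: (subvP (sub_chain _ _ (ltn0Sn j))); apply: (subvP (addvSr _ _)).
      by apply/lineP; exists 1; rewrite act1.
    by rewrite ch0 memv0 (negPf h0).
  have Dj : j = r.+1.
    apply/eqP; rewrite -(eqn_pmul2r dimD_gt0) -dim_skew_module -chT dimj.
    by rewrite dimv0.
  suff limr : limg (linfun (skew_mulr h)) = fullv.
    have := limg_ker_dim (linfun (skew_mulr h)) fullv.
    by rewrite capfv limr -{2}[\dim fullv]add0n => /addIn/eqP; rewrite dimv_eq0.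
  apply/eqP; rewrite eqEsubv subvf /=; apply/subvP=> v _.
  have: v \in chain 0%VS h j by rewrite chT memvf.
  move=> /chainP[x]; rewrite memv0 subr_eq0 Dj => /eqP->.
  apply/memv_imgP; exists [ffun i : 'I_r.+1 => iter i tau (x i)].
    exact: memvf.
  rewrite lfunE /= /skew_mulr /skew_mul; apply: eq_bigr => i _.
  by rewrite ffunE (act_iter_shift tauK dC).
split.
  exists e0; apply/eqP=> /ffunP/(_ ord0); rewrite !ffunE.
  exact/eqP/oner_neq0.
move=> a a0; have ker_l : lker (linfun (skew_mul tau d a)) == 0%VS.
  rewrite -subv0; apply/subvP=> b; rewrite memv_ker lfunE /= memv0.
  apply: contraTT => b0; apply: contra a0 => /eqP ab0.
  have /lker0P inj := ker_r b b0; apply/eqP/inj.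
  by rewrite !lfunE /= /skew_mulr ab0 skew_mul0l.
split.
  by apply: eq_bij (lker0_bijective ker_l) _ _ => x; rewrite lfunE.
by apply: eq_bij (lker0_bijective (ker_r a a0)) _ _ => x; rewrite lfunE.
Qed.

Definition skew_norm b := \prod_(i < r.+1) iter i tau b.

(** Comparing coordinates, u_(i-1) = tau^i(b) u_i and d u_r = b u_0. So u_r
    determines u, and going once around gives d u_r = b tau(b) ... tau^r(b) u_r.
    *)
Lemma eigen_norm b u : u != 0 -> T u = act b u -> d = skew_norm b.
Proof.
move=> u0 Tu; have Tui (i : 'I_r.+1) : (0 < i)%N ->
    u (inord i.-1) = iter i tau b * u i.
  by move=> i0; have /ffunP/(_ i) := Tu; rewrite !ffunE gtn_eqF.
have Tu0 : d * u ord_max = b * u ord0.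
  by have /ffunP/(_ ord0) := Tu; rewrite !ffunE.
have uE i : (i <= r)%N ->
    b * u ord0 = (\prod_(l < i.+1) iter l tau b) * u (inord i).
  elim: i => [|i IHi] le_ir.
    rewrite big_ord1; congr (_ * u _); apply: val_inj; by rewrite /= inordK.
  rewrite IHi 1?ltnW // [in RHS]big_ord_recr /= -mulrA; congr (_ * _).
  by have := Tui (inord i.+1); rewrite inordK //= => ->.
have u_max : u ord_max != 0.
  apply: contraNneq u0 => um0.
  suff u_i i : (i <= r)%N -> u (inord (r - i)) = 0.
    apply/eqP/ffunP=> i; rewrite ffunE -(u_i (r - i)%N) ?leq_subr //.
    by rewrite subKn ?leq_ord // inord_val.
  elim: i => [_|i IHi lt_ir].
    rewrite subn0 -[X in _ = X]um0; congr (u _); apply: val_inj.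
    by rewrite /= inordK.
  have lt_r : (r - i < r.+1)%N by rewrite ltnS leq_subr.
  have := Tui (inord (r - i)); rewrite inordK // subnS => -> //.
    by rewrite IHi ?mulr0 // ltnW.
  by rewrite subn_gt0.
apply: (mulIr (unitD u_max)); rewrite Tu0 (uE r) //; congr (_ * u _).
by apply: val_inj; rewrite /= inordK.
Qed.

Lemma mem1_full U : stable U -> e0 \in U -> U = fullv.
Proof. by move=> stU; apply: mem_mono_full; rewrite ?oner_neq0. Qed.

(** On D itself, though not on all of V, T^r.+1 is multiplication by d. *)
Lemma iter_r_mono x : iter r.+1 T (mono 0 x) = act d (mono 0 x).
Proof.
rewrite iter_shift_r; apply/ffunP=> l; rewrite !ffunE /=.
by case: eqP => [->|]; rewrite ?mulr0.
Qed.

(** Modulo U, T^i 1 is the scalar c_i with c_(i+1) = tau^-1(c_i) b, so that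
    d = T^r.+1 1 is tau(b) ... tau^r(b) b. Since d is central, the factor b can
    be moved to the front. *)
Lemma coeigen_norm U b : stable U -> U <> fullv ->
  T e0 - act b e0 \in U -> d = skew_norm b.
Proof.
move=> stU U'T Ub; have [stA stT] := stU.
pose s := iter r tau.
pose fix c i := if i is j.+1 then s (c j) * b else 1.
have cE i : iter i T e0 - act (c i) e0 \in U.
  elim: i => [|i IHi]; first by rewrite act1 subrr mem0v.
  rewrite iterS /= actM -[X in X - _](subrK (T (act (c i) e0))) -raddfB.
  rewrite -addrA memvD ?stT // [T (act _ _)]shift_act -raddfB.
  exact: stA.
have tau_c i : iter i tau (c i) = \prod_(l < i) iter l.+1 tau b.
  elim: i => [|i IHi]; first by rewrite big_ord0.
  rewrite big_ord_recr -IHi [LHS](rmorphM (iter i.+1 tau)); congr (_ * _).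
  rewrite -[LHS]/(iter i.+1 tau (iter r tau (c i))).
  by rewrite -iterD addSnnS iterD tauK.
have Dd : d = (\prod_(l < r) iter l.+1 tau b) * b.
  have := cE r.+1; rewrite iter_r_mono -actBl; set e := d - _ => Ue.
  have := tau_c r.+1; rewrite tauK big_ord_recr /= -iterS tauK => <-.
  apply/eqP; rewrite -subr_eq0 -/e; apply: contraT => e0.
  by case: U'T; apply: mem1_full => //; apply: act_mem_unit Ue e0.
have [b0|b0] := eqVneq b 0.
  by rewrite Dd /skew_norm big_ord_recl b0 mulr0 mul0r.
apply: (mulIr (unitD b0)); rewrite {1}dC {1}Dd mulrA; congr (_ * _).
by rewrite /skew_norm big_ord_recl.
Qed.

(** The case h = 1 of the chain, which then exhausts V. *)
Lemma stable_codim U : stable U -> U <> fullv -> exists j,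
  [/\ (0 < j)%N, (\dim U + j * N)%N = (r.+1 * N)%N,
      (exists x : nat -> D,
         iter j T e0 - \sum_(i < j) act (x i) (iter i T e0) \in U) &
      forall x : nat -> D,
        \sum_(i < j) act (x i) (iter i T e0) \in U ->
        forall i, (i < j)%N -> x i = 0].
Proof.
move=> stU U'T; have [j [stj dimj relj freej]] := chain_exists e0 stU.
exists j; case: j => [|j] in stj dimj relj freej *.
  by case: U'T; apply: mem1_full => //; case: relj => x; rewrite big_ord0 subr0.
split=> //; rewrite -dimj -dim_skew_module; congr (\dim _).
apply: mem1_full => //; apply: (subvP (sub_chain _ _ (ltn0Sn j))) => /=.
by apply: (subvP (addvSr _ _)); apply/lineP; exists 1; rewrite act1.
Qed.

Lemma stable_line_norm U : stable U -> \dim U = N -> exists b, d = skew_norm b.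
Proof.
move=> [stA stT] dimU.
have [u Uu u0] : exists2 u, u \in U & u != 0.
  exists (vpick U); first exact: memv_pick.
  by rewrite vpick0 -dimv_eq0 dimU -lt0n dimD_gt0.
have DU : U = line u.
  apply/esym/eqP; rewrite eqEdim; apply/andP; split.
    by apply/subvP=> _ /lineP[x ->]; apply: stA.
  rewrite dimU -[line u]add0v dim_add_line ?dimv0 ?memv0 //.
  by case: stable0.
have := stT u Uu; rewrite {1}DU => /lineP[b Tu]; exists b.
exact: eigen_norm Tu.
Qed.

(** With r.+1 <= 3, a proper nonzero subspace has D-dimension or D-codimension
    1. *)
Lemma simple_low_degree : (r <= 2)%N -> (forall b, d <> skew_norm b) ->
  forall U, stable U -> U = 0%VS \/ U = fullv.
Proof.
move=> le_r2 normP U stU.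
have [->|U0] := eqVneq U 0%VS; [by left | right].
apply/eqP; apply: contraT => /eqP U'T.
have [j [j0 dimU relj _]] := stable_codim stU U'T.
have lt_jr : (j < r.+1)%N.
  rewrite -(ltn_pmul2r dimD_gt0) -dimU -[X in (X < _)%N]add0n ltn_add2r.
  by rewrite lt0n dimv_eq0.
have [Dj|] := eqVneq j r.
  suff dim1 : \dim U = N by have [b] := stable_line_norm stU dim1; case/normP.
  by move: dimU; rewrite Dj mulSn => /addIn.
move=> ne_jr; have Dj : j = 1%N.
  apply/eqP; rewrite eqn_leq j0 andbT -ltnS (leq_trans _ le_r2) //.
  by rewrite ltn_neqAle ne_jr -ltnS.
have [x] := relj; rewrite Dj big_ord1 => Ux.
by case: (normP (x 0%N)); apply: coeigen_norm Ux.
Qed.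

Section RootOfUnity.

Variable w : k.
Hypothesis w_root : r.+1.-primitive_root w.

(** For c^(r+1) = 1 this is the automorphism t |-> c t of the skew polynomials,
    which fixes t^r.+1 - d. *)
Definition twist (c : k) v : V := [ffun l : 'I_r.+1 => c ^+ l *: v l].

Fact twist_linear c : linear (twist c).
Proof.
move=> t u v; apply/ffunP=> l; rewrite !ffunE scalerDr !scalerA.
by rewrite mulrC.
Qed.

HB.instance Definition _ c :=
  GRing.isLinear.Build k V V *:%R (twist c) (twist_linear c).

Lemma twist_act c x v : twist c (act x v) = act x (twist c v).
Proof. by apply/ffunP=> l; rewrite !ffunE scalerAr. Qed.

Lemma twist_shift c v : c ^+ r.+1 = 1 -> twist c (T v) = c *: T (twist c v).
Proof.
move=> c1; apply/ffunP=> l; rewrite !ffunE; case: posnP => [->|l0].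
  by rewrite scale1r -scalerAr scalerA -exprS c1 scale1r.
by rewrite inordK ?scalerA -?exprS ?prednK // ltnW.
Qed.

Lemma twist_stable c U : c ^+ r.+1 = 1 ->
  stable U -> stable (linfun (twist c) @: U).
Proof.
move=> c1 [stA stT]; have c0 : c != 0.
  apply: contraPneq c1 => ->; rewrite expr0n /=; apply/eqP.
  by rewrite eq_sym oner_neq0.
split=> [x|] _ /memv_imgP[v Uv ->]; rewrite lfunE /=.
  by rewrite -twist_act -[twist _ _]lfunE memv_img ?stA.
rewrite -[T _]scale1r -(mulVf c0) -scalerA -twist_shift // memvZ //.
by rewrite -[twist _ _]lfunE memv_img ?stT.
Qed.

(** The lines t^j D are the eigenspaces of the twist, with distinct eigenvalues
    w^j. A nonzero U stable under the twist thus contains some t^j x with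
    x != 0. *)
Lemma twist_full U : stable U -> U != 0%VS ->
  (forall v, v \in U -> twist w v \in U) -> U = fullv.
Proof.
move=> stU U0 twU; have [v Uv v0] : exists2 v, v \in U & v != 0.
  by exists (vpick U); [apply: memv_pick | rewrite vpick0].
have [j vj0] : exists j, v j != 0.
  apply/existsP; apply: contraNT v0; rewrite negb_exists => /forallP v0.
  by apply/eqP/ffunP=> j; rewrite ffunE; apply/eqP/negPn.
(* The product of the operators twist w - w^i for i in s multiplies the
   coordinate l by c s l. *)
pose c (s : seq 'I_r.+1) (l : 'I_r.+1) := \prod_(i <- s) (w ^+ l - w ^+ i).
have Uc s : [ffun l => c s l *: v l] \in U.
  elim: s => [|i s IHs].
    suff -> : [ffun l => c [::] l *: v l] = v by [].
    by apply/ffunP=> l; rewrite ffunE /c big_nil scale1r.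
  suff -> : [ffun l => c (i :: s) l *: v l] =
      twist w [ffun l => c s l *: v l] - w ^+ i *: [ffun l => c s l *: v l].
    by rewrite memvB ?twU ?memvZ.
  apply/ffunP=> l; rewrite !ffunE /c big_cons !scalerA -scalerBl.
  by rewrite mulrBl.
have cj0 : c (enum (predC1 j)) j != 0.
  rewrite /c big_enum_cond /= prodf_seq_neq0; apply/allP=> i _; apply/implyP.
  rewrite inE /= subr_eq0 (eq_prim_root_expr w_root) !modn_small // eq_sym.
  by rewrite -val_eqE andbT.
apply: (@mem_mono_full _ j (c (enum (predC1 j)) j *: v j)) => //.
- exact: leq_ord.
- by rewrite scaler_eq0 negb_or cj0.
suff -> : mono j (c (enum (predC1 j)) j *: v j) =
   [ffun l => c (enum (predC1 j)) l *: v l] :> V by [].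
apply/ffunP=> l; rewrite !ffunE val_eqE; case: eqP => [->//|/eqP ne_lj].
have -> : c (enum (predC1 j)) l = 0; last by rewrite scale0r.
apply/eqP; rewrite /c prodf_seq_eq0; apply/hasP; exists l.
  by rewrite mem_enum.
by rewrite /= subrr.
Qed.

Lemma twist_inj c : c != 0 -> lker (linfun (twist c)) == 0%VS.
Proof.
move=> c0; rewrite -subv0; apply/subvP=> v; rewrite memv_ker lfunE /= memv0.
move=> /eqP/ffunP cv; apply/eqP/ffunP=> l; have := cv l; rewrite !ffunE.
by move/eqP; rewrite scaler_eq0 expf_eq0 (negPf c0) andbF => /eqP.
Qed.

(** The image of the minimal subspace U is minimal too, so that it lies in W or
    meets W trivially. *)
Lemma dim_add_twist U W c : c ^+ r.+1 = 1 -> stable U -> stable W ->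
  (forall Z, stable Z -> (Z <= U)%VS -> Z <> U -> Z = 0%VS) ->
  \dim (W + linfun (twist c) @: U) = \dim W \/
  \dim (W + linfun (twist c) @: U) = (\dim W + \dim U)%N.
Proof.
move=> c1 stU stW minU; have c0 : c != 0.
  apply: contraPneq c1 => ->; rewrite expr0n /=; apply/eqP.
  by rewrite eq_sym oner_neq0.
pose f := linfun (twist c); pose Z := (U :&: f @^-1: W)%VS.
have stZ : stable Z.
  have [[stA stT] [stA' stT']] := (stU, stW).
  split=> [x|] v; rewrite !memv_cap -!memv_preim !lfunE /= => /andP[Uv Wv].
    by rewrite stA // twist_act stA'.
  by rewrite stT // twist_shift // memvZ ?stT'.
have [ZU|/eqP ZU] := eqVneq Z U.
  left; congr (\dim _); apply/addv_idPl/subvP=> _ /memv_imgP[u Uu ->].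
  by rewrite memv_preim; move: Uu; rewrite -ZU memv_cap => /andP[].
right; rewrite dimv_disjoint_sum.
  by rewrite limg_dim_eq // (eqP (twist_inj c0)) capv0.
apply/eqP; rewrite -subv0; apply/subvP=> v; rewrite memv_cap => /andP[Wv].
move=> /memv_imgP[u Uu Dv].
have Zu : u \in Z by rewrite memv_cap Uu -memv_preim -Dv.
have /eqP u0 : u == 0 by rewrite -memv0 -(minU Z stZ (capvSl _ _) ZU).
by rewrite Dv u0 linear0 mem0v.
Qed.

(** The sum of the images of a minimal U under the powers of the twist by w is
    V, by [twist_full], and its dimension is a multiple of that of U, by
    [dim_add_twist]. So the D-dimension of U divides the prime r.+1. The
    induction on the dimension serves to have U minimal: smaller counterexamples
    have been excluded before. *)
Lemma simple_prime : prime r.+1 -> (forall b, d <> skew_norm b) ->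
  forall U, stable U -> U = 0%VS \/ U = fullv.
Proof.
move=> r_prime normP U.
have [q] := ubnP (\dim U); elim: q U => // q IHq U ltUq stU.
have [->|U0] := eqVneq U 0%VS; [by left | right].
apply/eqP; apply: contraT => /eqP U'T.
have minU Z : stable Z -> (Z <= U)%VS -> Z <> U -> Z = 0%VS.
  move=> stZ sZU neZU; have ltZU : (\dim Z < \dim U)%N.
    rewrite ltnNge; apply/negP=> leUZ; case: neZU; apply/eqP.
    by rewrite eqEdim sZU.
  have [//|ZT] := IHq Z (leq_trans ltZU ltUq) stZ.
  by move: ltZU; rewrite ZT ltnNge dimvS ?subvf.
have wK c : (w ^+ c) ^+ r.+1 = 1.
  by rewrite exprAC (prim_expr_order w_root) expr1n.
pose S j := (\sum_(i < j) linfun (twist (w ^+ i)) @: U)%VS.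
have S0 : S 0%N = 0%VS by rewrite /S big_ord0.
have SS j : S j.+1 = (S j + linfun (twist (w ^+ j)) @: U)%VS.
  by rewrite /S big_ord_recr.
have stS j : stable (S j).
  elim: j => [|j [stA stT]]; first by rewrite S0; apply: stable0.
  have [stA' stT'] := twist_stable (wK j) stU; rewrite SS.
  split=> [x|] _ /memv_addP[u Su [v Uv ->]]; rewrite raddfD.
    by rewrite memv_add ?stA ?stA'.
  by rewrite memv_add ?stT ?stT'.
have dimS j : (\dim U %| \dim (S j))%N.
  elim: j => [|j IHj]; first by rewrite S0 dimv0.
  rewrite SS.
  by have [->|->] := dim_add_twist (wK j) stU (stS j) minU; rewrite ?dvdn_addl.
have sSU i j : (i < j)%N -> (linfun (twist (w ^+ i)) @: U <= S j)%VS.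
  elim: j => // j IHj; rewrite SS ltnS leq_eqVlt => /predU1P[->|/IHj sij].
    exact: addvSr.
  exact: subv_trans sij (addvSl _ _).
have twistM c e v : twist c (twist e v) = twist (c * e) v.
  by apply/ffunP=> l; rewrite !ffunE scalerA exprMn.
have twS j : (j <= r.+1)%N -> forall v, v \in S j -> twist w v \in S r.+1.
  elim: j => [_ v|j IHj lt_jr v].
    by rewrite S0 memv0 => /eqP->; rewrite linear0 mem0v.
  rewrite SS => /memv_addP[u Su [_ /memv_imgP[{}v Uv ->] ->]].
  rewrite linearD; apply: memvD; first exact: (IHj (ltnW lt_jr)).
  rewrite lfunE /= twistM -exprS -[twist _ _]lfunE -(prim_expr_mod w_root).
  by apply: (subvP (sSU (j.+1 %% r.+1)%N _ _)); rewrite ?ltn_mod ?memv_img.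
have ST : S r.+1 = fullv.
  apply: twist_full => //; last exact: twS.
  rewrite -dimv_eq0 -lt0n (leq_trans _ (dimvS (sSU 0%N _ _))) //.
  rewrite limg_dim_eq ?lt0n ?dimv_eq0 //.
  by rewrite (eqP (twist_inj _)) ?capv0 // expr0 oner_neq0.
have [j [j0 dimU _ _]] := stable_codim stU U'T.
have lt_jr : (j < r.+1)%N.
  rewrite -(ltn_pmul2r dimD_gt0) -dimU -[X in (X < _)%N]add0n ltn_add2r.
  by rewrite lt0n dimv_eq0.
have dimUE : \dim U = ((r.+1 - j) * N)%N.
  by rewrite mulnBl -dimU addnK.
have := dimS r.+1; rewrite ST dim_skew_module dimUE dvdn_pmul2r ?dimD_gt0 //.
case/primeP: r_prime => _ /[apply] /orP[/eqP rj1|].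
  have dim1 : \dim U = N by rewrite dimUE rj1 mul1n.
  by have [b] := stable_line_norm stU dim1; case/normP.
by rewrite eqn_leq [X in _ && X]leqNgt ltn_subrL j0 andbF.
Qed.

End RootOfUnity.

End SkewModule.

(** * Factorizations give zero divisors *)

Section Converse.

Variables (k : fieldType) (D : falgType k) (r : nat).
Variables (tau : {lrmorphism D -> D}) (d : D).
Local Notation V := {ffun 'I_r.+1 -> D}.

Lemma division_mul_eq0 (g h : V) :
  division_algebra (skew_mul tau d : V -> V -> V) -> g != 0 ->
  skew_mul tau d g h = 0 -> h = 0.
Proof.
move=> [_ divV] /divV[[f fK _] _] gh0; apply: (can_inj fK).
by rewrite gh0 raddf0.
Qed.

(** If d = b tau(b) ... tau^r(b), then T has an eigenvector u for b, and
    (t - b) u = 0. *)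
Lemma division_norm b : (0 < r)%N ->
  division_algebra (skew_mul tau d : V -> V -> V) -> d <> skew_norm r tau b.
Proof.
move=> r0 divV Dd.
pose u : V := [ffun l : 'I_r.+1 => \prod_(l.+1 <= i < r.+1) iter i tau b].
have u0 : u != 0.
  apply/eqP=> /ffunP/(_ ord_max); rewrite !ffunE big_geq //.
  by apply/eqP/oner_neq0.
case/eqP: u0; apply: (division_mul_eq0 (g := mono 1 1 - mono 0 b) divV).
  apply/eqP=> /ffunP/(_ (inord 1)); rewrite !ffunE inordK //= subr0.
  by apply/eqP/oner_neq0.
rewrite skew_mulDl -raddfN !skew_mul_monol //= act1.
rewrite -[act _ _ _]/(actr tau u _) raddfN /=; apply/eqP; rewrite subr_eq0.
apply/eqP/ffunP=> l; rewrite !ffunE; case: posnP => [l0|l0].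
  rewrite l0 /= big_geq // mulr1 Dd /skew_norm.
  by rewrite -(big_mkord xpredT (fun i => iter i tau b)) big_ltn.
rewrite inordK; last exact: leq_ltn_trans (leq_pred _) (ltn_ord l).
by rewrite prednK // big_ltn.
Qed.

End Converse.

(** * Degree four *)

Section Quartic.

Variables (k : fieldType) (D : falgType k).
Variables (tau : {lrmorphism D -> D}) (d : D).
Local Notation V := {ffun 'I_4 -> D}.
Local Notation act := (act tau).
Local Notation T := (@shift D 3 d).
Local Notation e0 := (@mono D 3 0 1).

Hypothesis tauK : iter 4 tau =1 id.
Hypothesis dC : forall x, d * x = x * d.

(** t^2 - z1 t - z0. *)
Definition quad_factor z0 z1 : V := T (T e0) - (act z0 e0 + act z1 (T e0)).

(** Right division of t^4 - d by t^2 - z1 t - z0: the quotient is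
    t^2 + y1 t + y0, and the remainder, which appears here with the opposite
    sign, vanishes exactly if the two equations of the theorem hold. *)
Lemma quad_factor_mul z0 z1
    (y0 := iter 2 tau z0 + iter 2 tau z1 * iter 3 tau z1)
    (y1 := iter 2 tau z1) (h := quad_factor z0 z1) :
  T (T h) + act y1 (T h) + act y0 h =
  act (d - y0 * z0) e0 - act (y1 * iter 3 tau z0 + y0 * z1) (T e0).
Proof.
have TA x v : T (act x v) = act (iter 3 tau x) (T v) by rewrite shift_act.
have tau6 x : iter 3 tau (iter 3 tau x) = iter 2 tau x.
  by rewrite -iterD -[in RHS](tauK x) -iterD.
have T4 : T (T (T (T e0))) = act d e0 := iter_r_mono 3 tau d 1.
have y0E v : act y0 v = act (iter 2 tau z0) v + act (y1 * iter 3 tau z1) v.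
  by rewrite -actDl.
have y1E : iter 2 tau z1 = y1 by [].
clearbody y0 y1; rewrite /h /quad_factor !raddfB !raddfD /=.
rewrite !TA !tau6 T4 -!actM y1E.
rewrite actBl actDl [act y0 (T _)]y0E.
(* Of the ten terms, 1, 9, 5 and 10 remain; the others cancel in pairs. *)
rewrite !opprD [LHS](AC ((1*2)*(1*2)*(2*2)) ((1*9)*(5*10)*(7*2)*(4*3)*(8*6))).
by rewrite /= !subrr !addr0 -opprD.
Qed.

Hypothesis unitD : forall x : D, x != 0 -> x \is a GRing.unit.
Hypothesis d_neq0 : d != 0.

(** Codimensions 1 and 3 are excluded by the condition on norms. In codimension
    2 the relation for T^2 1 says that U contains some t^2 - z1 t - z0. By
    [quad_factor_mul] U then contains a combination of 1 and T 1, whose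
    coefficients must vanish. *)
Lemma simple_quartic :
  (forall b, d <> skew_norm 3 tau b) ->
  (forall z0 z1,
      iter 2 tau z1 * iter 3 tau z1 * z1 + iter 2 tau z0 * z1
        + iter 2 tau z1 * iter 3 tau z0 <> 0 \/
      iter 2 tau z0 * z0 + iter 2 tau z1 * iter 3 tau z1 * z0 <> d) ->
  forall U : {vspace V}, stable tau d U -> U = 0%VS \/ U = fullv.
Proof.
move=> normP quadP U stU; have N0 := dimD_gt0 D.
have [->|U0] := eqVneq U 0%VS; [by left | right].
apply/eqP; apply: contraT => /eqP U'T.
have [j [j0 dimU relj freej]] := stable_codim unitD tauK dC d_neq0 stU U'T.
have lt_j4 : (j < 4)%N.
  rewrite -(ltn_pmul2r N0) -dimU -[X in (X < _)%N]add0n ltn_add2r.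
  by rewrite lt0n dimv_eq0.
case: j => [|[|[|[|j]]]] // in j0 dimU relj freej lt_j4 *.
- have [x] := relj; rewrite big_ord1 => Ux.
  by case: (normP (x 0%N)); apply: coeigen_norm Ux.
- have [stA stT] := stU; have [x] := relj.
  rewrite !big_ord_recl big_ord0 addr0 /= => Uh.
  set z0 := x 0%N in Uh; set z1 := x 1%N in Uh.
  pose y0 := iter 2 tau z0 + iter 2 tau z1 * iter 3 tau z1.
  have Uq : quad_factor z0 z1 \in U := Uh.
  pose c i : D := if i is 0%N then d - y0 * z0 else
            - (iter 2 tau z1 * iter 3 tau z0 + y0 * z1).
  have Uc : \sum_(i < 2) act (c i) (iter i T e0) \in U.
    rewrite !big_ord_recl big_ord0 addr0 /= -[act (- _) _]/(actr tau (T e0) _).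
    rewrite raddfN /= -[_ - _](quad_factor_mul z0 z1).
    by rewrite !memvD ?stA ?stT.
  have /eqP := freej c Uc 0%N isT; rewrite subr_eq0 mulrDl => /eqP Dd.
  have /eqP := freej c Uc 1%N isT; rewrite oppr_eq0 mulrDl => /eqP E0.
  have [] := quadP z0 z1; last by rewrite -Dd.
  by case; rewrite -[RHS]E0 addrC [X in _ + X]addrC.
have dim1 : \dim U = \dim {:D}.
  by move: dimU; rewrite [in RHS]mulSn => /addIn.
by have [b] := stable_line_norm unitD stU dim1; case/normP.
Qed.

Theorem division_quartic :
  division_algebra (skew_mul tau d : V -> V -> V) <->
  (forall b, d <> skew_norm 3 tau b) /\
  (forall z0 z1,
      iter 2 tau z1 * iter 3 tau z1 * z1 + iter 2 tau z0 * z1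
        + iter 2 tau z1 * iter 3 tau z0 <> 0 \/
      iter 2 tau z0 * z0 + iter 2 tau z1 * iter 3 tau z1 * z0 <> d).
Proof.
split=> [divV|[normP quadP]]; last first.
  exact: (simple_division unitD tauK dC (simple_quartic normP quadP)).
split=> [b|z0 z1]; first exact: division_norm divV.
have [Dd|/eqP ne_d] := eqVneq
  (iter 2 tau z0 * z0 + iter 2 tau z1 * iter 3 tau z1 * z0) d; last by right.
left=> E0; pose y1 := iter 2 tau z1.
pose y0 := iter 2 tau z0 + y1 * iter 3 tau z1.
have := oner_neq0 D; case/eqP.
suff /ffunP/(_ (inord 2)) : quad_factor z0 z1 = 0.
  rewrite /quad_factor !shift_mono //= !act_mono !ffunE inordK //=.
  by rewrite addr0 subr0.
apply: (division_mul_eq0 (g := mono 2 1 + mono 1 (tau y1) + mono 0 y0) divV).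
  apply/eqP=> /ffunP/(_ (inord 2)); rewrite !ffunE !inordK //= !addr0.
  by apply/eqP/oner_neq0.
rewrite !skew_mulDl !skew_mul_monol //= act1 -(act_shift tauK dC).
rewrite quad_factor_mul.
rewrite mulrDl Dd subrr act0l sub0r [_ + _ * z1]addrC mulrDl [X in X + _]addrC.
by rewrite E0 act0l oppr0.
Qed.

End Quartic.

(** * The regular representation and the reduced norm *)

Section Map.

Variables (S S' : nzRingType) (r : nat).

Definition ffun_map (f : S -> S') (v : {ffun 'I_r.+1 -> S}) :
  {ffun 'I_r.+1 -> S'} := [ffun i => f (v i)].

Fact ffun_map_zmod_morphism (f : {additive S -> S'}) :
  zmod_morphism (ffun_map f).
Proof. by move=> v w; apply/ffunP=> i; rewrite !ffunE raddfB. Qed.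

HB.instance Definition _ (f : {additive S -> S'}) :=
  GRing.isZmodMorphism.Build {ffun 'I_r.+1 -> S} {ffun 'I_r.+1 -> S'}
    (ffun_map f) (ffun_map_zmod_morphism f).

Lemma ffun_map_mono (f : {additive S -> S'}) i z :
  ffun_map f (mono i z) = mono i (f z).
Proof. by apply/ffunP=> l; rewrite !ffunE; case: eqP; rewrite ?raddf0. Qed.

Variables (f : {rmorphism S -> S'}).
Variables (rho : {rmorphism S -> S}) (rho' : {rmorphism S' -> S'}) (a : S).

Lemma ffun_mapM v w : (forall x, f (rho x) = rho' (f x)) ->
  ffun_map f (skew_mul rho a v w) =
  skew_mul rho' (f a) (ffun_map f v) (ffun_map f w).
Proof.
move=> f_rho; rewrite !skew_mulE raddf_sum; apply: eq_bigr => i _.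
rewrite raddf_sum; apply: eq_bigr => j _ /=.
have f_iter : f (iter j rho (v i)) = iter j rho' (f (v i)).
  by elim: (j : nat) => //= l <-.
by case: ifP => _; rewrite ffun_map_mono /= !rmorphM f_iter !ffunE.
Qed.

End Map.

Section RegularRepresentation.

Variables (E : fieldType) (r : nat) (rho : {rmorphism E -> E}) (a : E).
Local Notation C := (cyclic_carrier E r.+1).
Local Notation mul := (skew_mul rho a).
Local Notation T := (@shift E r a).
Implicit Types x y v w : C.

(** Left multiplication by x on the right E-space with basis the e^j. *)
Definition reg_mx x : 'M[E]_r.+1 := \matrix_(i, j) mul x (mono j 1) i.

Lemma reg_mx_mul x y i : mul x y i = \sum_j reg_mx x i j * y j.
Proof.
pose rm z v : C := [ffun l => v l * z].
have rmD z v w : rm z (v + w) = rm z v + rm z w.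
  by apply/ffunP=> l; rewrite !ffunE mulrDl.
have rm0 z : rm z 0 = 0 by apply/ffunP=> l; rewrite !ffunE mul0r.
have rmT z v : rm z (T v) = T (rm z v).
  by apply/ffunP=> l; rewrite !ffunE; case: eqP => // _; rewrite mulrA.
have rmA z e v : rm z (act rho e v) = act rho e (rm z v).
  by apply/ffunP=> l; rewrite !ffunE mulrA.
have rmM z v w : rm z (mul v w) = mul v (rm z w).
  rewrite /skew_mul (big_morph _ (rmD z) (rm0 z)); apply: eq_bigr => l _.
  rewrite -rmA; elim: (l : nat) => //= q <-; exact: rmT.
rewrite {1}[y]sum_mono raddf_sum sum_ffunE; apply: eq_bigr => j _ /=.
have -> : mono j (y j) = rm (y j) (mono j 1) :> C.
  by apply/ffunP=> l; rewrite !ffunE; case: eqP; rewrite ?mul1r ?mul0r.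
by rewrite -rmM ffunE mxE.
Qed.

Lemma reg_mxD x y : reg_mx (x + y) = reg_mx x + reg_mx y.
Proof. by apply/matrixP=> i j; rewrite !mxE skew_mulDl ffunE. Qed.

Lemma reg_mx1 : reg_mx (mono 0 1) = 1%:M.
Proof.
apply/matrixP=> i j; rewrite !mxE [mul _ _](skew_mul1l rho a) ffunE val_eqE.
by case: eqP.
Qed.

Lemma reg_mx_mono0 z : rho z = z -> reg_mx (mono 0 z) = z%:M.
Proof.
move=> rho_z; apply/matrixP=> i j.
rewrite !mxE skew_mul_monol //= !ffunE val_eqE.
have -> : iter i rho z = z by elim: (i : nat) => //= q ->.
by case: eqP => _; rewrite ?mulr1 ?mulr0.
Qed.

Hypothesis rhoK : iter r.+1 rho =1 id.
Hypothesis rho_a : rho a = a.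

Lemma reg_mxM x y : reg_mx (mul x y) = reg_mx x *m reg_mx y.
Proof.
apply/matrixP=> i j; rewrite !mxE.
rewrite -[mul (mul x y) _](skew_mulA rhoK (mulrC a) rho_a).
by rewrite reg_mx_mul; apply: eq_bigr => l _; rewrite [reg_mx y l j]mxE.
Qed.

Lemma reg_mx_map (f : {rmorphism E -> E}) x :
  (forall z, f (rho z) = rho (f z)) -> f a = a ->
  reg_mx (ffun_map f x) = map_mx f (reg_mx x).
Proof.
move=> f_rho f_a; apply/matrixP=> i j; rewrite !mxE.
have e_j : ffun_map f (mono j 1) = mono j 1 :> C.
  by rewrite ffun_map_mono /= rmorph1.
by rewrite -{1}e_j -{1}f_a -(ffun_mapM _ _ _ f_rho) ffunE.
Qed.

Hypothesis a_neq0 : a != 0.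

(** Conjugation by e acts on D as rho acts on coordinates, since
    z e = e rho(z) for z in E. As e is invertible (e^r.+1 = a), the determinants
    of x and of its image by rho agree; the latter is rho of the former. *)
Lemma det_reg_mx_fixed x : rho (\det (reg_mx x)) = \det (reg_mx x).
Proof.
pose eps := T (mono 0 1).
have epsM v : mul eps v = T v.
  by rewrite skew_mul_shift ?skew_mul1l //; apply: mulrC.
have eps_unit : reg_mx eps \in unitmx.
  have /mulmx1_unit[] // :
    reg_mx eps *m reg_mx (iter r T (mono 0 a^-1)) = 1%:M.
  rewrite -reg_mxM epsM -iterS iter_shift_r -reg_mx1; congr reg_mx.
  apply/ffunP=> l.
  by rewrite !ffunE; case: eqP; rewrite ?mulr0 ?mulfV.
have comm : mul x eps = mul eps (ffun_map rho x).
  rewrite epsM [x]sum_mono skew_mul_suml !raddf_sum; apply: eq_bigr => i _ /=.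
  rewrite ffun_map_mono skew_mul_monol ?leq_ord // /eps.
  rewrite (act_shift rhoK (mulrC a)).
  rewrite act_mono /= mulr1 -iterSr iterS iter_shift_mono ?leq_ord //.
  by rewrite addn0 leq_ord.
have := congr1 (fun y => \det (reg_mx y)) comm.
rewrite !reg_mxM !det_mulmx reg_mx_map // mulrC det_map_mx => Deps.
have eps0 : \det (reg_mx eps) != 0 by rewrite -unitfE -unitmxE.
exact/esym/(mulfI eps0).
Qed.

End RegularRepresentation.

Section Splitting.

Variables (F : fieldType) (E : fieldExtType F) (r : nat).
Variables (rho : {rmorphism E -> E}) (a : E).
Local Notation C := (cyclic_carrier E r.+1).
Local Notation mul := (skew_mul rho a).
Local Notation reg_mx := (@reg_mx E r rho a).

Hypothesis rhoK : iter r.+1 rho =1 id.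
Hypothesis rho_a : rho a = a.
Hypothesis a_neq0 : a != 0.
Hypothesis rhoF : forall y : F, rho y%:A = y%:A.
Hypothesis dimE : \dim {:E} = r.+1.
Variable b : 'I_r.+1 -> E.
Hypothesis b_unit : (\matrix_(p, j < r.+1) iter j rho (b p)) \in unitmx.

Lemma reg_mxZ (t : F) (x : C) : reg_mx (t *: x) = t%:A *: reg_mx x.
Proof.
have rhoZ j z : iter j rho (t *: z) = t%:A * iter j rho z.
  by elim: j z => [|j IHj] z /=; [rewrite mulr_algl | rewrite IHj rmorphM rhoF].
apply/matrixP=> i j; rewrite !mxE /skew_mul !sum_ffunE mulr_sumr.
apply: eq_bigr => p _; rewrite ffunE act_mono rhoZ act_mono -mulrA.
rewrite !iter_shift_mono ?leq_ord //; case: ifP => _; rewrite !ffunE;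
  case: eqP => _; rewrite ?mulr0 //.
by rewrite mulrCA.
Qed.

(** As the matrix of the rho^j(b_p) is invertible, there are w_p in E for which
    the sum of the w_p rho^j(b_p) is 1 for j = j0 and 0 otherwise. With the same
    coefficients, the matrices of the e^i b_p combine to one whose only nonzero
    column is e^i e^j0, in position j0; and i can be chosen to place its entry
    in any row. So the image of D spans all matrices; the dimensions agree. *)
Lemma reg_mx_splitting :
  splitting (mul : C -> C -> C) (mono 0 1) (in_alg E) reg_mx.
Proof.
split.
- exact: reg_mxD.
- exact: reg_mxZ.
- exact: reg_mxM.
- exact: reg_mx1.
set X := [seq _ | _ <- _].
have span_reg x : reg_mx x \in <<X>>%VS.
  rewrite (coord_vbasis (memvf x)).
  have reg0 : reg_mx 0 = 0.
    by rewrite -[0](scale0r (0 : C)) reg_mxZ scale0r scale0r.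
  rewrite (big_morph _ (reg_mxD rho a) reg0) memv_suml // => i _.
  by rewrite reg_mxZ memvZ // memv_span // map_f // mem_nth // size_tuple.
rewrite basisEdim; apply/andP; split; last first.
  by rewrite size_map size_tuple dim_ffun_ord dimE dimvf.
apply/subvP=> M _; rewrite [M]matrix_sum_delta memv_suml // => i0 _.
rewrite memv_suml // => j0 _; rewrite memvZ //.
pose w : 'rV_r.+1 :=
  delta_mx 0 j0 *m invmx (\matrix_(p, j < r.+1) iter j rho (b p)).
have wE (j : 'I_r.+1) : \sum_p w 0 p * iter j rho (b p) = (j == j0)%:R.
  have : (w *m \matrix_(p, j < r.+1) iter j rho (b p)) 0 j =
      (delta_mx 0 j0 : 'rV_r.+1) 0 j.
    by rewrite /w mulmxKV.
  rewrite [LHS]mxE [RHS]mxE eqxx => <-; apply: eq_bigr => p _.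
  by congr (_ * _); rewrite mxE.
(* i is i0 - j0 modulo r.+1, and q is a if the exponent wraps around. *)
have [i le_ir [q q0 monoE]] : exists2 i : nat, (i <= r)%N &
    exists2 q : E, q != 0 & iter i (@shift E r a) (mono j0 1) = mono i0 q.
  have [lt_i0 lt_j0] := (leq_ord i0, leq_ord j0).
  have [le_j0i0|lt_i0j0] := leqP j0 i0.
    exists (i0 - j0)%N; first exact: leq_trans (leq_subr _ _) _.
    exists 1; first exact: oner_neq0.
    by rewrite iter_shift_mono ?subnK ?lt_i0 // (leq_trans (leq_subr _ _)).
  have Di : (i0 + r.+1 - j0 + j0 = i0 + r.+1)%N.
    by rewrite subnK // (leq_trans lt_j0) // addnS ltnW // ltnS leq_addl.
  have le_ir : (i0 + r.+1 - j0 <= r)%N.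
    by rewrite -(leq_add2r j0) Di addnS -addSn addnC leq_add2l.
  exists (i0 + r.+1 - j0)%N => //; exists a => //.
  by rewrite iter_shift_mono // Di addnK addnS ltnNge leq_addl mulr1.
suff -> : delta_mx i0 j0 = q^-1 *: \sum_p w 0 p *: reg_mx (mono i (b p)).
  by rewrite memvZ // memv_suml // => p _; rewrite memvZ.
apply/matrixP=> i' j; rewrite [LHS]mxE [RHS]mxE summxE.
transitivity (q^-1 * iter i (@shift E r a) (mono j (j == j0)%:R) i').
  case: (eqVneq j j0) => [->|_]; last by rewrite andbF !raddf0 ffunE mulr0.
  by rewrite andbT monoE ffunE val_eqE; case: eqP; rewrite ?mulr0 ?mulVf.
congr (_ * _); rewrite -wE.
under [RHS]eq_bigr do
  rewrite mxE [reg_mx _ _ _]mxE skew_mul_monol // act_mono mulr1.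
rewrite iter_shift_mono ?leq_ord //; under [RHS]eq_bigr do
  rewrite iter_shift_mono ?leq_ord //.
case: ifP => _; rewrite ffunE; case: eqP => [ei|ne_i].
- by apply: eq_bigr => p _; rewrite ffunE ei eqxx.
- by rewrite big1 // => p _; rewrite ffunE; case: eqP => //; rewrite mulr0.
- by rewrite mulr_sumr; apply: eq_bigr => p _; rewrite ffunE ei eqxx mulrCA.
by rewrite big1 // => p _; rewrite ffunE; case: eqP => //; rewrite mulr0.
Qed.

End Splitting.

(** * Cyclic Galois extensions *)

Lemma big_cycle (gT : finGroupType) (R : Type) (idx : R)
    (op : Monoid.com_law idx) (x : gT) (f : gT -> R) :
  \big[op/idx]_(y in <[x]>%g) f y = \big[op/idx]_(i < #[x]%g) f (x ^+ i)%g.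
Proof.
have -> : <[x]>%g = [set (x ^+ (i : 'I_#[x]%g))%g | i : 'I_#[x]%g].
  apply/setP=> y; apply/idP/imsetP=> [/cyclePmin[i lt_i ->]|[i _ ->]].
    by exists (Ordinal lt_i).
  exact: mem_cycle.
rewrite big_imset /=; last first.
  move=> i j _ _ /eqP; rewrite eq_expg_mod_order !modn_small //.
  by move/eqP/val_inj.
by apply: eq_bigl => i.
Qed.

Section CyclicGalois.

Variables (F0 : fieldType) (L : splittingFieldType F0) (n : nat).
Variable sigma : gal_of {:L}.
Hypothesis galL : galois 1 {:L}.
Hypothesis dimL : \dim {:L} = n.
Hypothesis genL : ('Gal({:L} / 1))%g = <[sigma]>%g.

Lemma order_gal_generator : #[sigma]%g = n.
Proof. by rewrite /order -genL -galois_dim // dimv1 divn1. Qed.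

Lemma gal_iter i x : (sigma ^+ i)%g x = iter i sigma x.
Proof.
elim: i x => [|i IHi] x; first by rewrite expg0 gal_id.
by rewrite expgSr galM ?memvf //= IHi.
Qed.

Lemma gal_iter_order : iter n sigma =1 id.
Proof.
by move=> x; rewrite -gal_iter -order_gal_generator expg_order gal_id.
Qed.

Lemma galTrace_iter x : galTrace 1 {:L} x = \sum_(i < n) iter i sigma x.
Proof.
rewrite /galTrace genL big_cycle order_gal_generator.
by apply: eq_bigr => i _; rewrite gal_iter.
Qed.

Lemma galNorm_iter x : galNorm 1 {:L} x = \prod_(i < n) iter i sigma x.
Proof.
rewrite /galNorm genL big_cycle order_gal_generator.
by apply: eq_bigr => i _; rewrite gal_iter.
Qed.

(** Linear independence of the automorphisms prevents their sum from being 0. *)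
Lemma galTrace_neq0 : exists a (t : F0), t != 0 /\ galTrace 1 {:L} a = t%:A.
Proof.
have [|a _] := @gal_independent_contra _ _ {:L} (mem 'Gal({:L} / 1)%g)
   (fun=> 1) 1%g (group1 _); first exact: oner_neq0.
under eq_bigr do rewrite mul1r.
rewrite -/(galTrace 1 {:L} a) => tr0.
have /vlineP[t Dt] := mem_galTrace galL (memvf a).
exists a, t; split=> //; apply: contraNneq tr0.
by rewrite Dt => ->; rewrite scale0r.
Qed.

(** A relation between the columns would be a linear relation between the
    automorphisms sigma^j. *)
Lemma dedekind_unitmx (b : 'I_n -> L) :
  (forall x, exists y : 'I_n -> F0, x = \sum_p y p *: b p) ->
  (\matrix_(p, j < n) iter j sigma (b p)) \in unitmx.
Proof.
move=> spanb; rewrite -unitmx_tr -row_free_unit -kermx_eq0.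
apply/rowV0P=> c /sub_kermxP cM.
have cb p : \sum_j c 0 j * iter j sigma (b p) = 0.
  have /rowP/(_ p) := cM; rewrite [LHS]mxE [RHS]mxE => c0.
  by rewrite -[RHS]c0; apply: eq_bigr => j _; rewrite 2!mxE.
have cx x : \sum_(j < n) c 0 j * (sigma ^+ j)%g x = 0.
  have [y ->] := spanb x; under eq_bigr do rewrite linear_sum mulr_sumr.
  rewrite exchange_big big1 //= => p _.
  under eq_bigr do rewrite linearZ /= gal_iter -scalerAr.
  by rewrite -scaler_sumr cb scaler0.
have := @gal_independent _ _ {:L} xpredT
  (fun g => \sum_(j < n | (sigma ^+ j)%g == g) c 0 j).
have inj_sigma (i j : 'I_n) : ((sigma ^+ i)%g == (sigma ^+ j)%g) = (i == j).
  by rewrite eq_expg_mod_order order_gal_generator !modn_small.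
move=> gal0; apply/rowP=> i; rewrite mxE.
rewrite -(gal0 _ (sigma ^+ i)%g isT) => [|x _].
  by rewrite (big_pred1 i) // => j; rewrite inj_sigma.
rewrite -[RHS](cx x).
rewrite [RHS](partition_big (fun j : 'I_n => sigma ^+ j)%g xpredT) //=.
apply: eq_bigr => g _; rewrite mulr_suml; apply: eq_bigr => j /eqP <- //.
Qed.

End CyclicGalois.

(** * The composite field *)

Section Composite.

Variables (F0 : fieldType) (L F : splittingFieldType F0) (n : nat).
Variable sigma : gal_of {:L}.
Hypothesis galL : galois 1 {:L}.
Hypothesis dimL : \dim {:L} = n.
Hypothesis genL : ('Gal({:L} / 1))%g = <[sigma]>%g.
Variables (K : fieldExtType F) (iL : {rmorphism L -> K}).
Hypothesis hK : disjoint_composite iL.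

Local Notation b := (vbasis {:L}).

Lemma composite_scale (t : F0) x : iL (t *: x) = (t%:A : F) *: iL x.
Proof.
have [iL_alg _ _] := hK.
by rewrite -[t *: x]mulr_algl rmorphM /= iL_alg mulr_algl.
Qed.

(** Linear disjointness gives independence. The F-span of L is closed under
    products, so that it is the subalgebra generated by L. *)
Lemma composite_basis : basis_of {:K} (map iL b).
Proof.
have [_ iL_free iL_gen] := hK; set X := map iL b in iL_gen *.
rewrite /basis_of iL_free ?(basis_free (vbasisP _)) // andbT.
have XiL x : iL x \in <<X>>%VS.
  rewrite (coord_vbasis (memvf x)) rmorph_sum memv_suml // => i _.
  rewrite [iL _]composite_scale memvZ // memv_span // map_f // mem_nth //.
  by rewrite size_tuple.
rewrite eqEsubv subvf -iL_gen /=; apply: agenv_sub_modl.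
  by rewrite -memvE -(rmorph1 iL) XiL.
apply/prodvP=> u v /memv_addP[_ /vlineP[t ->] [w Xw ->]] Xv.
rewrite mulrDl mulr_algl memvD ?memvZ //.
rewrite (coord_span (X := map_tuple iL b) Xw).
rewrite (coord_span (X := map_tuple iL b) Xv).
rewrite mulr_suml memv_suml // => i _; rewrite mulr_sumr memv_suml // => j _.
rewrite -scalerAl -scalerAr !memvZ //.
by rewrite !(nth_map 0) ?size_tuple // -rmorphM XiL.
Qed.

Lemma dim_composite : \dim {:K} = n.
Proof.
rewrite -dimL; apply: (size_basis (X := map_tuple iL b)).
exact: composite_basis.
Qed.

Lemma composite_span z :
  exists y : 'I_(\dim {:L}) -> F, z = \sum_p y p *: iL b`_p.
Proof.
exists (fun p => coord (map_tuple iL b) p z).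
have Xz : z \in <<map_tuple iL b>>%VS.
  by rewrite (span_basis composite_basis) memvf.
rewrite {1}(coord_span Xz); apply: eq_bigr => p _.
by rewrite (nth_map 0) ?size_tuple.
Qed.

Lemma composite_eq_rmorph (f g : {rmorphism K -> K}) :
  (forall x, f (iL x) = g (iL x)) -> (forall y : F, f y%:A = g y%:A) -> f =1 g.
Proof.
move=> fgL fgF z; have [y ->] := composite_span z; rewrite !rmorph_sum.
by apply: eq_bigr => p _; rewrite -[y p *: _]mulr_algl !rmorphM fgL fgF.
Qed.

Variable sigmaK : {rmorphism K -> K}.
Hypothesis sigmaKL : forall x : L, sigmaK (iL x) = iL (sigma x).
Hypothesis sigmaKF : forall y : F, sigmaK y%:A = y%:A.

Lemma sigmaK_iter_iL i x : iter i sigmaK (iL x) = iL (iter i sigma x).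
Proof. by elim: i => //= i ->; rewrite sigmaKL. Qed.

Lemma sigmaK_iter_F i (y : F) : iter i sigmaK y%:A = y%:A.
Proof. by elim: i => //= i ->; rewrite sigmaKF. Qed.

Lemma sigmaK_order : iter n sigmaK =1 id.
Proof.
apply: (composite_eq_rmorph (f := iter n sigmaK) (g := idfun)) => [x|y] /=.
  by rewrite sigmaK_iter_iL (gal_iter_order galL dimL genL).
exact: sigmaK_iter_F.
Qed.

(** The matrix comes from L, where its determinant is nonzero. *)
Lemma composite_unitmx :
  (\matrix_(p < n, j < n) iter j sigmaK (iL b`_p)) \in unitmx.
Proof.
have -> : \matrix_(p < n, j < n) iter j sigmaK (iL b`_p) =
    map_mx iL (\matrix_(p < n, j < n) iter j sigma (b`_p)).
  by apply/matrixP=> p j; rewrite !mxE sigmaK_iter_iL.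
rewrite map_unitmx; case: n / dimL; apply: (dedekind_unitmx galL) => // x.
by exists (fun p => coord b p x); rewrite {1}(coord_vbasis (memvf x)).
Qed.

(** If a in L has trace t != 0 in F0, then z t is the trace of z a, because z is
    fixed; and all traces from K lie in F, as those from L lie in F0. *)
Lemma sigmaK_fixed z : sigmaK z = z -> exists y : F, z = y%:A.
Proof.
move=> sigma_z; have [a [t [t0 tr_a]]] := galTrace_neq0 galL.
have iter_z i : iter i sigmaK z = z by elim: i => //= i ->.
have trF u : exists y : F, \sum_(i < n) iter i sigmaK u = y%:A.
  have [y ->] := composite_span u.
  have tr_b p : exists s : F,
      \sum_(i < n) iter i sigmaK (y p *: iL b`_p) = s%:A.
    have /vlineP[s Ds] := mem_galTrace galL (memvf b`_p).
    exists (y p * s%:A); have [iL_alg _ _] := hK.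
    rewrite -[RHS]scalerA -iL_alg -Ds (galTrace_iter galL dimL genL) rmorph_sum.
    rewrite scaler_sumr; apply: eq_bigr => i _.
    rewrite -[y p *: iL _]mulr_algl rmorphM /= sigmaK_iter_F sigmaK_iter_iL.
    by rewrite mulr_algl.
  have trD : \sum_(i < n) iter i sigmaK (\sum_p y p *: iL b`_p) =
      \sum_p \sum_(i < n) iter i sigmaK (y p *: iL b`_p).
    by rewrite exchange_big; apply: eq_bigr => i _; rewrite raddf_sum.
  rewrite trD; elim: (index_enum _) => [|p s [q IHs]].
    by exists 0; rewrite big_nil scale0r.
  have [q' Dq'] := tr_b p; exists (q' + q).
  by rewrite big_cons IHs Dq' scalerDl.
have [y trE] := trF (z * iL a); exists (y / t%:A).
have tA0 : (t%:A : F) != 0 by rewrite scaler_eq0 oner_eq0 orbF.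
apply: (mulIf (x := (t%:A : F)%:A)).
  by rewrite scaler_eq0 oner_eq0 orbF.
rewrite [RHS]mulr_algl scalerA mulfVK // -trE.
have [iL_alg _ _] := hK; rewrite -iL_alg -tr_a (galTrace_iter galL dimL genL).
rewrite rmorph_sum mulr_sumr; apply: eq_bigr => i _.
by rewrite [RHS]rmorphM /= iter_z sigmaK_iter_iL.
Qed.

End Composite.

(** * From the tensor product to V *)

Lemma division_iso (A B : zmodType) (mulA : A -> A -> A) (mulB : B -> B -> B)
    (psi : A -> B) :
  bijective psi -> psi 0 = 0 -> {morph psi : x y / mulA x y >-> mulB x y} ->
  division_algebra mulA <-> division_algebra mulB.
Proof.
move=> [phi psiK phiK] psi0 psiM.
have phi0 : phi 0 = 0 by rewrite -psi0 psiK.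
have psi_bij : bijective psi by exists phi.
have phi_bij : bijective phi by exists psi.
have phiM : {morph phi : x y / mulB x y >-> mulA x y}.
  by move=> x y; rewrite -{1}[x]phiK -{1}[y]phiK -psiM psiK.
have div X Y (mX : X -> X -> X) (mY : Y -> Y -> Y) (f : X -> Y) (g : Y -> X) :
    cancel f g -> cancel g f -> {morph f : x y / mX x y >-> mY x y} ->
    forall x, bijective (mX x) /\ bijective (mX^~ x) ->
    bijective (mY (f x)) /\ bijective (mY^~ (f x)).
  move=> fK gK fM x [bl br]; have f_bij : bijective f by exists g.
  have g_bij : bijective g by exists f.
  split; [apply: eq_bij (bij_comp (bij_comp f_bij bl) g_bij) _ _ => y |
          apply: eq_bij (bij_comp (bij_comp f_bij br) g_bij) _ _ => y];
  by rewrite /= fM gK.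
split=> -[[a a0] inv]; split.
- by exists (psi a); apply: contraNneq a0 => pa0; rewrite -[a]psiK pa0 phi0.
- move=> b b0; rewrite -[b]phiK.
  apply: (div _ _ mulA mulB psi phi) => //; apply: inv.
  by apply: contraNneq b0 => pb0; rewrite -[b]phiK pb0 psi0.
- by exists (phi a); apply: contraNneq a0 => pa0; rewrite -[a]phiK pa0 psi0.
move=> b b0; rewrite -[b]psiK.
apply: (div _ _ mulB mulA phi psi) => //; apply: inv.
by apply: contraNneq b0 => pb0; rewrite -[b]psiK pb0 phi0.
Qed.

(** A bilinear multiplicative map on A x B, whose values span an algebra W of
    dimension the product of those of A and B, identifies the tensor product of
    A and B with W. *)
Section TensorTransfer.

Variables (k : fieldType) (A B W : vectType k).
Variables (mulA : A -> A -> A) (mulB : B -> B -> B) (mulW : W -> W -> W).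
Variable g : A -> B -> W.
Hypothesis g_linl : forall b, linear (g^~ b).
Hypothesis g_linr : forall a, linear (g a).
Hypothesis mul_linl : forall w, linear (mulW^~ w).
Hypothesis mul_linr : forall w, linear (mulW w).
Hypothesis gM : forall a a' b b',
  g (mulA a a') (mulB b b') = mulW (g a b) (g a' b').
Hypothesis g_span : forall U : {vspace W},
  (forall a b, g a b \in U) -> U = fullv.
Hypothesis dimW : \dim {:W} = (\dim {:A} * \dim {:B})%N.

Local Notation e := (vbasis {:A}).
Local Notation f := (vbasis {:B}).

Let lin_sum (V V' : vectType k) (h : V -> V') (h_lin : linear h) I (s : seq I)
    (c : I -> k) (x : I -> V) :
  h (\sum_(i <- s) c i *: x i) = \sum_(i <- s) c i *: h (x i).
Proof.
pose h' : {linear V -> V'} := HB.pack h (GRing.isLinear.Build _ _ _ _ h h_lin).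
rewrite -[h]/(h' : V -> V') linear_sum; apply: eq_bigr => i _.
by rewrite linearZ.
Qed.

Definition tensor_map (M : 'M[k]_(\dim {:A}, \dim {:B})) : W :=
  \sum_i \sum_j M i j *: g e`_i f`_j.

Fact tensor_map_linear : linear tensor_map.
Proof.
move=> t M M'; rewrite /tensor_map scaler_sumr -big_split.
apply: eq_bigr => i _.
rewrite scaler_sumr -big_split; apply: eq_bigr => j _ /=.
by rewrite !mxE scalerDl scalerA.
Qed.

HB.instance Definition _ :=
  GRing.isLinear.Build k _ W *:%R tensor_map tensor_map_linear.

Lemma tensor_map_tensor a b : tensor_map (tensor a b) = g a b.
Proof.
rewrite {2}(coord_vbasis (memvf a)) (lin_sum (g_linl b)); apply: eq_bigr => i _.
rewrite {2}(coord_vbasis (memvf b)) (lin_sum (g_linr _)) scaler_sumr.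
by apply: eq_bigr => j _; rewrite mxE scalerA.
Qed.

Lemma tensor_mapM : {morph tensor_map :
  M M' / tensor_mul mulA mulB M M' >-> mulW M M'}.
Proof.
move=> M M'; rewrite /tensor_mul.
have lin2 (h : W -> W) : linear h -> forall N : 'M[k]_(\dim {:A}, \dim {:B}),
    h (tensor_map N) = \sum_i \sum_j N i j *: h (g e`_i f`_j).
  move=> h_lin N; rewrite /tensor_map.
  pose h' : {linear W -> W} := HB.pack h (GRing.isLinear.Build _ _ _ _ h h_lin).
  rewrite -[h]/(h' : W -> W) linear_sum; apply: eq_bigr => i _.
  by rewrite linear_sum; apply: eq_bigr => j _; rewrite linearZ.
rewrite [RHS](lin2 _ (mul_linl (tensor_map M'))) linear_sum.
apply: eq_bigr => i _.
rewrite linear_sum; apply: eq_bigr => j _.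
rewrite /= (lin2 _ (mul_linr _)) linear_sum scaler_sumr; apply: eq_bigr => p _.
rewrite linear_sum scaler_sumr; apply: eq_bigr => q _.
by rewrite linearZ /= scalerA tensor_map_tensor gM.
Qed.

Lemma tensor_map_bij : bijective tensor_map.
Proof.
pose h := linfun tensor_map.
have limgh : limg h = fullv.
  apply: g_span => a b; rewrite -tensor_map_tensor -[tensor_map _]lfunE.
  exact: memv_img (memvf _).
have kerh : lker h == 0%VS.
  have := limg_ker_dim h fullv; rewrite capfv limgh dimW.
  rewrite [in RHS]dimvf /dim /= -[RHS]add0n => /addIn/eqP.
  by rewrite dimv_eq0.
apply: (@eq_bij _ _ h) => [|M]; last by rewrite lfunE.
exists (h^-1)%VF; first exact: lker0_lfunK.
by move=> w; apply: limg_lfunVK; rewrite limgh memvf.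
Qed.

Lemma tensor_division :
  division_algebra (tensor_mul mulA mulB) <-> division_algebra mulW.
Proof.
apply: (division_iso tensor_map_bij); [exact: raddf0 | exact: tensor_mapM].
Qed.

End TensorTransfer.

Section BaseMap.

Variables (F0 : fieldType) (F : fieldExtType F0) (K : fieldExtType F).
Local Notation K0 := (baseFieldType K).
Variable f : {rmorphism K -> K}.

(** The extension of tau to K is linear over F0 but not over F. The proof of
    linearity is an argument so that the linear structure can be inferred. *)
Definition base_map
  of (forall (t : F0) (x : K), f ((t%:A : F) *: x) = (t%:A : F) *: f x)
  : K0 -> K0 := f.

Variable fZ :
  forall (t : F0) (x : K), f ((t%:A : F) *: x) = (t%:A : F) *: f x.

HB.instance Definition _ :=
  GRing.isZmodMorphism.Build K0 K0 (base_map fZ) (raddfB f).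
HB.instance Definition _ :=
  GRing.isMonoidMorphism.Build K0 K0 (base_map fZ) (rmorph1 f, rmorphM f).
HB.instance Definition _ :=
  GRing.isScalable.Build F0 K0 K0 *:%R (base_map fZ) fZ.

End BaseMap.

Section CyclicMap.

Variables (k : fieldType) (E : fieldExtType k) (r : nat) (X : cyclic_data E r).
Local Notation D := (cyclic_ring X).
Variable f : {lrmorphism E -> E}.

Definition cyclic_ring_map of (forall x, f (cyc_aut X x) = cyc_aut X (f x))
  & f (cyc_cst X) = cyc_cst X : D -> D := ffun_map f.

Hypothesis f_aut : forall x, f (cyc_aut X x) = cyc_aut X (f x).
Hypothesis f_cst : f (cyc_cst X) = cyc_cst X.
Local Notation fD := (cyclic_ring_map f_aut f_cst).

Fact cyclic_ring_map_zmod_morphism : zmod_morphism fD.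
Proof. by move=> x y; apply: (raddfB (ffun_map f)). Qed.

Fact cyclic_ring_map_monoid_morphism : monoid_morphism fD.
Proof.
split=> [|x y]; first by rewrite /cyclic_ring_map [LHS]ffun_map_mono /= rmorph1.
by rewrite /cyclic_ring_map [LHS](ffun_mapM _ _ _ f_aut) /= f_cst.
Qed.

Fact cyclic_ring_map_scalable : scalable fD.
Proof. by move=> t x; apply/ffunP=> i; rewrite !ffunE linearZ. Qed.

HB.instance Definition _ :=
  GRing.isZmodMorphism.Build D D fD cyclic_ring_map_zmod_morphism.
HB.instance Definition _ :=
  GRing.isMonoidMorphism.Build D D fD cyclic_ring_map_monoid_morphism.
HB.instance Definition _ :=
  GRing.isScalable.Build k D D *:%R fD cyclic_ring_map_scalable.

Lemma iter_cyclic_ring_map i (x : D) :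
  iter i fD x = [ffun l => iter i f (x l)].
Proof.
elim: i => [|i IHi] /=; first by apply/ffunP=> l; rewrite ffunE.
by rewrite IHi; apply/ffunP=> l; rewrite !ffunE.
Qed.

End CyclicMap.

(** * The tensor product of the two cyclic algebras *)

Section SkewCyclicTensor.

Variables (F0 : fieldType) (L F : splittingFieldType F0) (r q : nat).
Variables (sigma : gal_of {:L}) (tau : gal_of {:F}).
Hypothesis galL : galois 1 {:L}.
Hypothesis dimL : \dim {:L} = r.+1.
Hypothesis genL : ('Gal({:L} / 1))%g = <[sigma]>%g.
Hypothesis galF : galois 1 {:F}.
Hypothesis dimF : \dim {:F} = q.+1.
Hypothesis genF : ('Gal({:F} / 1))%g = <[tau]>%g.
Variables (K : fieldExtType F) (iL : {rmorphism L -> K}).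
Hypothesis hK : disjoint_composite iL.
Variable sigmaK : {rmorphism K -> K}.
Hypothesis sigmaKL : forall x : L, sigmaK (iL x) = iL (sigma x).
Hypothesis sigmaKF : forall y : F, sigmaK y%:A = y%:A.
Variable tauK : {rmorphism K -> K}.
Hypothesis tauKL : forall x : L, tauK (iL x) = iL x.
Hypothesis tauKF : forall y : F, tauK y%:A = (tau y)%:A.
Variables (d : F) (c : F0).
Hypothesis c_neq0 : c != 0.
Hypothesis d_neq0 : d != 0.

Local Notation K0 := (baseFieldType K).
Local Notation cK := ((c%:A : F)%:A : K).

Lemma sigmaK_scale (t : F0) (x : K) :
  sigmaK ((t%:A : F) *: x) = (t%:A : F) *: sigmaK x.
Proof. by rewrite -[_ *: x]mulr_algl rmorphM sigmaKF mulr_algl. Qed.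

Lemma tauK_scale (t : F0) (x : K) :
  tauK ((t%:A : F) *: x) = (t%:A : F) *: tauK x.
Proof. by rewrite -[_ *: x]mulr_algl rmorphM tauKF rmorph_alg mulr_algl. Qed.

Lemma sigmaK_ord : iter r.+1 sigmaK =1 id.
Proof. exact: (sigmaK_order galL dimL genL hK sigmaKL sigmaKF). Qed.

Lemma tauK_iter_F i (y : F) : iter i tauK y%:A = (iter i tau y)%:A.
Proof. by elim: i => //= i ->; rewrite tauKF. Qed.

Lemma tauK_ord : iter q.+1 tauK =1 id.
Proof.
apply: (composite_eq_rmorph hK (f := iter q.+1 tauK) (g := idfun)) => [x|y].
  by rewrite [LHS]iter_fix.
rewrite [LHS]tauK_iter_F; congr (_%:A).
exact: (gal_iter_order galF dimF genF).
Qed.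

Lemma tauK_sigmaK x : tauK (sigmaK x) = sigmaK (tauK x).
Proof.
suff eq_comp : tauK \o sigmaK =1 sigmaK \o tauK by exact: eq_comp x.
apply: (composite_eq_rmorph hK) => [z|y] /=.
  by rewrite sigmaKL !tauKL sigmaKL.
by rewrite sigmaKF tauKF sigmaKF.
Qed.

Let rho : {lrmorphism K0 -> K0} := base_map sigmaK_scale.
Let theta : {lrmorphism K0 -> K0} := base_map tauK_scale.

Let X : cyclic_data K0 r :=
  @CyclicData F0 K0 r rho cK sigmaK_ord (sigmaKF _).

Local Notation D := (cyclic_ring X).

Lemma theta_cst : tauK cK = cK.
Proof. by rewrite tauKF rmorph_alg. Qed.

Let tauD : {lrmorphism D -> D} :=
  @cyclic_ring_map _ _ _ X theta tauK_sigmaK theta_cst.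

Let cst (y : F) : D := mono 0 (y%:A : K).
Let emb (a : cyclic_carrier L r.+1) : D := ffun_map iL a.

Lemma cst_mulr (x : D) y : x * cst y = [ffun l => (x l : K) * y%:A].
Proof. exact: skew_mul_mono0r. Qed.

Lemma cst_mull (x : D) y : cst y * x = [ffun l => (x l : K) * y%:A].
Proof.
rewrite [LHS]skew_mul_monol //; apply/ffunP=> l; rewrite !ffunE mulrC.
congr (_ * _); exact: (sigmaK_iter_F sigmaKF).
Qed.

Lemma cst_comm y (x : D) : cst y * x = x * cst y.
Proof. by rewrite cst_mull cst_mulr. Qed.

Lemma cstM y z : cst (y * z) = cst y * cst z.
Proof.
rewrite cst_mulr; apply/ffunP=> l; rewrite !ffunE.
by case: eqP => _; rewrite ?mul0r // -scalerAl mul1r scalerA.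
Qed.

Lemma iter_tauD_cst i y : iter i tauD (cst y) = cst (iter i tau y).
Proof.
rewrite [LHS]iter_cyclic_ring_map; apply/ffunP=> l; rewrite !ffunE.
case: eqP => _; first exact: tauK_iter_F.
exact: (raddf0 (iter i tauK)).
Qed.

Lemma tauD_emb i a : iter i tauD (emb a) = emb a.
Proof.
rewrite [LHS]iter_cyclic_ring_map; apply/ffunP=> l; rewrite !ffunE.
exact: (iter_fix i (tauKL (a l))).
Qed.

Lemma embM a a' : emb (skew_mul sigma c%:A a a') = emb a * emb a'.
Proof.
have [iL_alg _ _] := hK.
rewrite /emb (ffun_mapM _ _ _ (fun x => esym (sigmaKL x))).
by rewrite [iL _]iL_alg.
Qed.

(** The image of a (x) b, namely the sum of the t^l a b_l. *)
Let g (a : cyclic_carrier L r.+1) (b : cyclic_carrier F q.+1) :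
  {ffun 'I_q.+1 -> D} := [ffun l => emb a * cst (b l)].

(** F is central in D, and tau is trivial on the algebra over L, so that both
    sides are obtained from the defining sums of b b' by the additive map
    y |-> a a' y. *)
Lemma gM a a' b b' :
  g (cyclic_mul sigma c%:A a a') (cyclic_mul tau d b b') =
  skew_mul tauD (cst d) (g a b) (g a' b').
Proof.
rewrite !cyclic_mulE.
pose h y : D := emb a * emb a' * cst y.
have h_zmod : zmod_morphism h.
  by move=> y z; rewrite /h -mulrBr /cst scalerBl raddfB.
pose h' : {additive F -> D} :=
  HB.pack h (GRing.isZmodMorphism.Build _ _ h h_zmod).
have -> : g (skew_mul sigma c%:A a a') (skew_mul tau d b b') =
    ffun_map h' (skew_mul tau d b b').
  by apply/ffunP=> l; rewrite !ffunE embM.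
have hE i (j : 'I_q.+1) :
    iter j tauD (g a b i) * g a' b' j = h (iter j tau (b i) * b' j).
  rewrite !ffunE rmorphM /= iter_tauD_cst tauD_emb /h cstM -!mulrA.
  congr (_ * _).
  by rewrite !mulrA cst_comm.
rewrite !skew_mulE raddf_sum; apply: eq_bigr => i _; rewrite raddf_sum.
apply: eq_bigr => j _ /=; rewrite -!mulrA hE.
case: ifP => _; rewrite [LHS](ffun_map_mono _ h') //=; congr (mono _ _).
by rewrite /h cstM mulrA -(cst_comm d) -mulrA.
Qed.

Lemma emb_linear : linear emb.
Proof.
move=> t a a'; apply/ffunP=> l; rewrite !ffunE rmorphD; congr (_ + _).
exact: (composite_scale hK).
Qed.

Lemma cst_linear : linear cst.
Proof.
move=> t y z; apply/ffunP=> l; rewrite !ffunE; case: eqP => _.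
  by rewrite scalerDl -[t *: y]mulr_algl -scalerA.
by rewrite scaler0 addr0.
Qed.

Lemma dim_base : \dim {:K0} = (r.+1 * q.+1)%N.
Proof.
have <- : baseVspace (fullv : {vspace K}) = (fullv : {vspace K0}).
  apply/vspaceP=> x; transitivity true; last by rewrite memvf.
  by rewrite mem_baseVspace; apply: (memvf (x : K)).
by rewrite dim_baseVspace (dim_composite dimL hK) dimF.
Qed.

Lemma tensor_division_skew :
  division_algebra
    (tensor_mul (cyclic_mul sigma c%:A : cyclic_carrier L r.+1 -> _ -> _)
                (cyclic_mul tau d : cyclic_carrier F q.+1 -> _ -> _)) <->
  division_algebra (skew_mul tauD (cst d) : {ffun 'I_q.+1 -> D} -> _ -> _).
Proof.
apply: (tensor_division (g := g)).
- move=> b t a a'; apply/ffunP=> l; rewrite !ffunE.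
  by rewrite emb_linear mulrDl -scalerAl.
- move=> a t b b'; apply/ffunP=> l; rewrite !ffunE.
  by rewrite cst_linear mulrDr -scalerAr.
- exact: skew_mulr_linear.
- by move=> w t u v; rewrite raddfD /= skew_mul_scalable.
- exact: gM.
- move=> U gU; apply/eqP; rewrite eqEsubv subvf; apply/subvP=> v _.
  rewrite [v]sum_mono memv_suml // => l _.
  rewrite [v l]sum_mono raddf_sum memv_suml // => i _.
  have [y ->] := composite_span hK (v l i : K).
  rewrite !raddf_sum memv_suml // => p _ /=.
  suff -> : mono l (mono i (y p *: iL (vbasis {:L})`_p) : D) =
     g (mono i (vbasis {:L})`_p) (mono l (y p)) :> {ffun 'I_q.+1 -> D} by [].
  apply/ffunP=> l'; rewrite !ffunE.
  case: eqP => _; last by rewrite /cst scale0r raddf0 mulr0.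
  rewrite cst_mulr; apply/ffunP=> i'; rewrite !ffunE.
  case: eqP => _; first by rewrite [RHS]mulrC [RHS]mulr_algl.
  by rewrite rmorph0 mul0r.
rewrite !dim_ffun_ord [\dim {:K0}]dim_base dimL dimF.
rewrite mulnCA -!mulnA; congr (_ * _)%N.
by rewrite mulnCA mulnA.
Qed.

Local Notation C := (cyclic_carrier K r.+1).
Local Notation mulD := (cyclic_mul sigmaK cK : C -> C -> C).

Hypothesis hD : division_algebra mulD.

Lemma unitD (x : D) : x != 0 -> x \is a GRing.unit.
Proof.
move=> x0; have [_ /(_ x x0)[[f _ fK] [h _ hK']]] := hD.
pose y : D := f (1 : D); pose z : D := h (1 : D).
have xy : x * y = 1 by rewrite -[RHS]fK cyclic_mulE.
have zx : z * x = 1 by rewrite -[RHS]hK' cyclic_mulE.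
apply/unitrP; exists y.
by rewrite -{1}[y]mul1r -{1}zx -[z * x * y]mulrA xy mulr1.
Qed.

Lemma tauD_ord : iter q.+1 tauD =1 id.
Proof.
move=> x; rewrite [LHS]iter_cyclic_ring_map; apply/ffunP=> l; rewrite ffunE.
exact: tauK_ord.
Qed.

Lemma cst_d_neq0 : cst d != 0.
Proof.
apply/eqP=> /ffunP/(_ ord0); rewrite !ffunE /= => /eqP.
by rewrite [_ == _]scaler_eq0 (negPf d_neq0) oner_eq0.
Qed.

Lemma simple_division_tensor :
  (forall U : {vspace {ffun 'I_q.+1 -> D}},
     stable tauD (cst d) U -> U = 0%VS \/ U = fullv) ->
  division_algebra
    (tensor_mul (cyclic_mul sigma c%:A : cyclic_carrier L r.+1 -> _ -> _)
                (cyclic_mul tau d : cyclic_carrier F q.+1 -> _ -> _)).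
Proof.
move=> simpleV; apply/tensor_division_skew.
exact: (simple_division unitD tauD_ord (cst_comm d) simpleV).
Qed.

(** The determinant of the regular representation turns tau on D into tau on F
    and is multiplicative, so that d, whose determinant is d^n, has the norm
    from F to F0 of the determinant y of z. *)
Lemma skew_norm_reduced_norm (z : D) : cst d = skew_norm q tauD z ->
  exists y : F, [/\ z != 0,
    is_reduced_norm mulD (cyclic_mono r.+1 0 1) (z : C) y &
    d ^+ r.+1 = galNorm 1 {:F} y].
Proof.
move=> Dd; pose R := @reg_mx K r sigmaK cK.
have cK_fixed : sigmaK cK = cK := sigmaKF _.
have cK0 : cK != 0 by rewrite !scaler_eq0 !oner_eq0 !orbF.
have [y Dy] := sigmaK_fixed galL dimL genL hK sigmaKL sigmaKF
                 (det_reg_mx_fixed sigmaK_ord cK_fixed cK0 (z : C)).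
exists y; split.
- apply: contraNneq cst_d_neq0 => z0; rewrite Dd z0 /skew_norm big_ord_recl.
  by rewrite mul0r.
- exists K, (in_alg K), r.+1, R; split; last exact: Dy.
  have [RD RZ RM R1 Rb] := reg_mx_splitting sigmaK_ord cK_fixed cK0 sigmaKF
    (dim_composite dimL hK) (composite_unitmx galL dimL genL sigmaKL).
  by split=> // u v; rewrite cyclic_mulE; apply: RM.
have normM (s : seq 'I_q.+1) :
    \det (R (\prod_(i <- s) iter i tauD z)) = (\prod_(i <- s) iter i tau y)%:A.
  elim: s => [|i s IHs].
    by rewrite !big_nil [R _]reg_mx1 det1 scale1r.
  rewrite !big_cons [R _](reg_mxM sigmaK_ord cK_fixed) det_mulmx IHs.
  have -> : \det (R (iter i tauD z)) = (iter i tau y)%:A.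
    rewrite -tauK_iter_F -Dy -det_map_mx; congr (\det _).
    elim: (i : nat) => [|j IHj]; first by apply/matrixP=> p p'; rewrite !mxE.
    transitivity (map_mx tauK (R (iter j tauD z))).
      exact: (reg_mx_map _ tauK_sigmaK theta_cst).
    by rewrite IHj; apply/matrixP=> p p'; rewrite !mxE.
  by rewrite -scalerAl mul1r scalerA.
have : \det (R (cst d)) = (galNorm 1 {:F} y)%:A.
  by rewrite Dd (galNorm_iter galF dimF genF); apply: normM.
rewrite [R _](reg_mx_mono0 r cK (sigmaKF d)) det_scalar.
rewrite -[d%:A]/(in_alg K d).
rewrite -rmorphXn; exact: fmorph_inj.
Qed.

Lemma tensor_division_prime :
  prime q.+1 ->
  (q.+1 <> 2%N -> q.+1 <> 3%N -> exists w : F0, q.+1.-primitive_root w) ->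
  ~ (exists (z : C) (y : F),
       [/\ z != 0, is_reduced_norm mulD (cyclic_mono r.+1 0 1) z y &
           d ^+ r.+1 = galNorm 1 {:F} y]) ->
  division_algebra
    (tensor_mul (cyclic_mul sigma c%:A : cyclic_carrier L r.+1 -> _ -> _)
                (cyclic_mul tau d : cyclic_carrier F q.+1 -> _ -> _)).
Proof.
move=> q_prime w_ex not_norm.
have normP (z : D) : cst d <> skew_norm q tauD z.
  by move=> /skew_norm_reduced_norm[y Dy]; apply: not_norm; exists z, y.
apply: simple_division_tensor; have [le_q2|lt_2q] := leqP q 2.
  exact: (simple_low_degree unitD tauD_ord (cst_comm d) cst_d_neq0 le_q2 normP).
have [||w w_root] := w_ex; first by move=> Dq; move: lt_2q; rewrite -ltnS Dq.
  by move=> Dq; move: lt_2q; rewrite -ltnS Dq.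
exact: (simple_prime unitD tauD_ord (cst_comm d) cst_d_neq0 w_root q_prime
  normP).
Qed.

Lemma tensor_division_quartic (t := fun i (z : C) => iter i (cyclic_map tauK) z)
    (dD := cyclic_mono r.+1 0 d%:A : C) : q = 3%N ->
  division_algebra
    (tensor_mul (cyclic_mul sigma c%:A : cyclic_carrier L r.+1 -> _ -> _)
                (cyclic_mul tau d : cyclic_carrier F q.+1 -> _ -> _)) <->
  (forall z, dD <> mulD (mulD (mulD z (t 1%N z)) (t 2%N z)) (t 3%N z)) /\
  (forall z0 z1,
     mulD (mulD (t 2%N z1) (t 3%N z1)) z1 + mulD (t 2%N z0) z1
       + mulD (t 2%N z1) (t 3%N z0) <> 0 \/
     mulD (t 2%N z0) z0 + mulD (mulD (t 2%N z1) (t 3%N z1)) z0 <> dD).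
Proof.
move=> Dq; apply: (iff_trans tensor_division_skew).
have := tauD_ord; rewrite Dq => tauD4.
apply: (iff_trans (division_quartic tauD4 (cst_comm d) unitD cst_d_neq0)).
have normE z :
  skew_norm 3 tauD z = mulD (mulD (mulD z (t 1%N z)) (t 2%N z)) (t 3%N z).
  rewrite /skew_norm !big_ord_recr big_ord0 /=; rewrite mul1r !cyclic_mulE.
  by [].
split=> -[normP quadP]; split=> [z|z0 z1].
- by rewrite -normE; apply: normP.
- by rewrite !cyclic_mulE; apply: quadP.
- by rewrite normE; apply: normP.
by have := quadP z0 z1; rewrite !cyclic_mulE.
Qed.

End SkewCyclicTensor.

Theorem theorem16
  (F0 : fieldType) (L F : splittingFieldType F0) (n m : nat)
  (sigma : gal_of {:L}) (tau : gal_of {:F})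
  (galL : galois 1 {:L}) (dimL : \dim {:L} = n)
  (genL : ('Gal({:L} / 1))%g = <[sigma]>%g)
  (galF : galois 1 {:F}) (dimF : \dim {:F} = m)
  (genF : ('Gal({:F} / 1))%g = <[tau]>%g)
  (* K = L (x)_{F0} F, presented as an extension of F *)
  (K : fieldExtType F) (iL : {rmorphism L -> K})
  (hK : disjoint_composite iL)
  (* the canonical extensions of sigma and tau to K *)
  (sigmaK : {rmorphism K -> K})
  (sigmaKL : forall x : L, sigmaK (iL x) = iL (sigma x))
  (sigmaKF : forall y : F, sigmaK y%:A = y%:A)
  (tauK : {rmorphism K -> K})
  (tauKL : forall x : L, tauK (iL x) = iL x)
  (tauKF : forall y : F, tauK y%:A = (tau y)%:A)
  (d : F) (hd : d \notin 1%VS)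
  (c : F0) (hc : c != 0)
  (mulD := cyclic_mul sigmaK (c%:A : F)%:A
             : cyclic_carrier K n -> cyclic_carrier K n -> cyclic_carrier K n)
  (hD : division_algebra mulD) :
  let t (i : nat) (z : cyclic_carrier K n) := iter i (cyclic_map tauK) z in
  let dD : cyclic_carrier K n := cyclic_mono n 0 d%:A in
  let oneD : cyclic_carrier K n := cyclic_mono n 0 1 in
  let T_division := division_algebra
        (tensor_mul (cyclic_mul sigma c%:A : cyclic_carrier L n -> _ -> _)
                    (cyclic_mul tau d : cyclic_carrier F m -> _ -> _)) in
  (m = 4%N ->
     (T_division <->
        (forall z, dD <> mulD (mulD (mulD z (t 1%N z)) (t 2%N z)) (t 3%N z)) /\
        (forall z0 z1,
           mulD (mulD (t 2%N z1) (t 3%N z1)) z1 + mulD (t 2%N z0) z1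
             + mulD (t 2%N z1) (t 3%N z0) <> 0 \/
           mulD (t 2%N z0) z0 + mulD (mulD (t 2%N z1) (t 3%N z1)) z0 <> dD)))
  /\
  (prime m ->
   (m <> 2%N -> m <> 3%N -> exists w : F0, m.-primitive_root w) ->
   [/\ tau (d ^+ n) <> d ^+ n -> T_division,
       ~ (exists (z : cyclic_carrier K n) (y : F),
            [/\ z != 0, is_reduced_norm mulD oneD z y &
                d ^+ n = galNorm 1 {:F} y]) -> T_division &
       d ^+ n \notin 1%VS -> T_division]).
Proof.
have d0 : d != 0 by apply: contraNneq hd => ->; apply: mem0v.
case: n dimL @mulD hD => [|r] dimL' mulD hD'.
  by have := adim_gt0 {:L}; rewrite dimL'.
case: m dimF => [|q] dimF' t dD oneD T_division.
  by have := adim_gt0 {:F}; rewrite dimF'.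
split=> [[Dq]|q_prime w_ex].
  exact: (tensor_division_quartic galL dimL' genL galF dimF' genF hK sigmaKL
    sigmaKF tauKL tauKF d0 hD' Dq).
have part_ii := tensor_division_prime galL dimL' genL galF dimF' genF hK sigmaKL
  sigmaKF tauKL tauKF hc d0 hD' q_prime w_ex.
have normF (y : F) : galNorm 1 {:F} y \in 1%VS.
  exact: mem_galNorm galF (memvf y).
split=> // [tau_d | dn]; apply: part_ii => -[z [y [_ _ Dy]]].
  apply: tau_d; have /vlineP[t' ->] : d ^+ r.+1 \in 1%VS by rewrite Dy.
  by rewrite linearZ /= rmorph1.
by move: dn; rewrite Dy normF.
Qed.
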